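(* Let $d\ge1$, $f$ a monic hyperbolic polynomial of degree $d$, $0\le s\le d$, and $u$ a composition of $d$. If $H_s^u(f)$ contains a polynomial whose composition is exactly $u$, then $\dim H_s^u(f)=\max\{\ell(u)-s,0\}$ and the relative interior of $H_s^u(f)$ is exactly the set of polynomials $h\in H_s^u(f)$ with $v(h)=u$.
   Context: Hyperbolic: all roots real. $f=t^d+f_1t^{d-1}+\dots+f_d$; $H_s(f)$ is the set of monic hyperbolic degree-$d$ polynomials $h=t^d+h_1t^{d-1}+\dots+h_d$ with $h_i=f_i$ for $1\le i\le s$, identified with $(h_{s+1},\dots,h_d)\in\mathbb{R}^{d-s}$ with the Euclidean subspace topology. Compositions of $d$: tuples of positive integers summing to $d$, length $\ell(u)$; $v\le u$ iff $v$ arises from $u$ by merging consecutive parts. $v(h)$ is the tuple of multiplicities of the distinct roots of $h$ in increasing order; $H_s^u(f)=\{h\in H_s(f):v(h)\le u\}$. Dimension is the dimension of a semialgebraic set. For a nonempty stratum of dimension $n$, its relative interior is the set of $h$ in it having an open neighbourhood (in the stratum) homeomorphic to an open subset of $\mathbb{R}^n$; its relative boundary is the complement of the relative interior in the stratum. *)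

(* Defs.v *)
From HB Require Import structures.
From mathcomp Require Import all_boot all_order all_algebra.
From mathcomp Require Import all_classical all_reals all_analysis.
Import numFieldNormedType.Exports.
Set Implicit Arguments. Unset Printing Implicit Defensive.
Import Order.TTheory GRing.Theory Num.Theory.
Local Open Scope classical_set_scope.
Local Open Scope ring_scope.

Definition hyperbolic (R : realType) (p : {poly R}) : Prop :=
  exists rs : seq R, p = \prod_(r <- rs) ('X - r%:P).

(* The monic degree-d polynomial
     t^d + f_1 t^(d-1) + ... + f_s t^(d-s) + x_1 t^(d-s-1) + ... + x_(d-s),
   where f_i = f`_(d-i) is the coefficient of t^(d-i) in f and
   x = (x_1,...,x_(d-s)) in R^(d-s) (stored 0-based as x 0 k). *)
Definition hpoly (R : realType) (d s : nat) (f : {poly R})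
    (x : 'rV[R]_(d - s)) : {poly R} :=
  'X^d
  + \sum_(i < s) f`_(d - i.+1) *: 'X^(d - i.+1)
  + \sum_(k < d - s) x ord0 k *: 'X^(d - (s + k.+1)).

Arguments hpoly {R} d s f x.

Definition Hs (R : realType) (d s : nat) (f : {poly R}) : set 'rV[R]_(d - s) :=
  [set x | hyperbolic (hpoly d s f x)].

Arguments Hs {R} d s f _.

Definition composition (d : nat) (u : seq nat) : Prop :=
  all (fun k => 0 < k)%N u /\ sumn u = d.

Definition comp_le (v u : seq nat) : Prop :=
  exists ss : seq (seq nat),
    flatten ss = u /\ all (fun b => b != [::]) ss /\ map sumn ss = v.

Definition root_mult_comp (R : realType) (h : {poly R}) (v : seq nat) : Prop :=
  exists rs : seq R,
    sorted <%R rs /\ (forall r, root h r <-> r \in rs) /\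
    v = map (fun r => mup r h) rs.

Definition Hsu (R : realType) (d s : nat) (f : {poly R}) (u : seq nat)
    : set 'rV[R]_(d - s) :=
  [set x | Hs d s f x /\
           exists v, root_mult_comp (hpoly d s f x) v /\ comp_le v u].

Arguments Hsu {R} d s f u _.

Definition homeomorphic_sets (X Y : topologicalType) (A : set X) (B : set Y)
    : Prop :=
  exists (phi : X -> Y) (psi : Y -> X),
    {within A, continuous phi} /\ {within B, continuous psi} /\
    (forall a, A a -> B (phi a)) /\ (forall b, B b -> A (psi b)) /\
    (forall a, A a -> psi (phi a) = a) /\ (forall b, B b -> phi (psi b) = b).

(* dim S = n : S contains a subset homeomorphic to a nonempty open subset
   of R^n, and no subset homeomorphic to a nonempty open subset of R^m
   for m > n.  (For semialgebraic S this is the semialgebraic dimension.) *)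
Definition sa_dim (R : realType) (N : nat) (S : set 'rV[R]_N) (n : nat)
    : Prop :=
  (exists (A : set 'rV[R]_N) (U : set 'rV[R]_n),
      A `<=` S /\ open U /\ U !=set0 /\ @homeomorphic_sets 'rV[R]_N 'rV[R]_n A U) /\
  (forall (m : nat) (A : set 'rV[R]_N) (U : set 'rV[R]_m),
      A `<=` S -> open U -> U !=set0 -> @homeomorphic_sets 'rV[R]_N 'rV[R]_m A U -> (m <= n)%N).

Definition rel_interior (R : realType) (N : nat) (S : set 'rV[R]_N) (n : nat)
    : set 'rV[R]_N :=
  [set h | S h /\
     exists (O : set 'rV[R]_N) (U : set 'rV[R]_n),
       open O /\ O h /\ open U /\ @homeomorphic_sets 'rV[R]_N 'rV[R]_n (S `&` O) U].

Arguments hyperbolic {R} p.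
Arguments root_mult_comp {R} h v.
Arguments homeomorphic_sets {X Y} A B.
Arguments sa_dim {R N} S n.
Arguments rel_interior {R N} S n _.

(* Main.v *)
(**
   A point of the stratum is a polynomial [h = prod_i (X - y_i)^(u_i)] with
   [y_1 <= ... <= y_l], [l = size u]. Comparing weighted power sums of two such
   vectors [y], [z] through [sum_i u_i (q(z_i) - q(y_i))], where [q'] changes
   sign exactly where [z - y] does, shows that

   - the first [l] coefficients of [h] determine [y], and
   - if [y_i = y_(i+1)], then fixing the first [l-1] coefficients the [l]-th
     one can move away from its value at [y] in one direction only.

   By the first point, projecting to the coefficients [h_(s+1), ..., h_l]
   embeds the stratum continuously into a space of dimension [max(l - s, 0)].
   Invariance of domain, applied to [y |-> (h_1, ..., h_l)] on the open chamber,
   shows that the image of the polynomials with [l] distinct roots is open; it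
   also bounds the dimension, and together with the second point it excludes
   the walls [y_i = y_(i+1)] from the relative interior.

   Invariance of domain itself is obtained as in Tao's proof from a form of
   Brouwer's theorem, which in turn comes from a mod 2 cup product of
   coboundaries on a cubical grid.
*)
Require Import Defs.
From HB Require Import structures.
From mathcomp Require Import all_boot all_order all_algebra.
From mathcomp Require Import all_classical all_reals all_analysis.
From mathcomp Require Import ring lra zify polyrcf.
Import numFieldNormedType.Exports.
Set Implicit Arguments. Unset Strict Implicit. Unset Printing Implicit Defensive.
Import Order.TTheory GRing.Theory Num.Theory.

Local Open Scope nat_scope.

(** * A parity lemma on cubical grids *)

Section GridParity.
Variables (n k : nat) (a : 'I_n -> {ffun 'I_n -> nat} -> bool).
Implicit Types (F : {ffun 'I_n -> nat} -> bool) (D : {set 'I_n}) (s t : seq 'I_n) (v w : {ffun 'I_n -> nat}).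

Definition upd v i c : {ffun 'I_n -> nat} := [ffun j => if j == i then c else v j].
Definition inc v i : {ffun 'I_n -> nat} := [ffun j => v j + (j == i)].

(* The value on the cube with base [v] and edge directions [D] of the
   mod 2 cup product of the coboundaries of the labels [a i], [i <- s]: a sum
   over the monotone edge paths of the cube. *)
Fixpoint cup s D v : bool :=
  if s is i :: s' then
    \big[addb/false]_(j in D) ((a i v (+) a i (inc v j)) && cup s' (D :\ j) (inc v j))
  else true.

Fixpoint box_sum s (F : {ffun 'I_n -> nat} -> bool) v : bool :=
  if s is i :: s' then \big[addb/false]_(c < k) box_sum s' F (upd v i c) else F v.

(** Modulo 2 the terms for (i, j) and (j, i) cancel. This is the cancellation behind d d = 0. *)
Lemma addb_sym_sum (D : {set 'I_n}) (G : 'I_n -> 'I_n -> bool) :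
  (forall i j, G i j = G j i) ->
  \big[addb/false]_(i in D) \big[addb/false]_(j in D :\ i) G i j = false.
Proof.
move=> symG.
have split_lt i : \big[addb/false]_(j in D :\ i) G i j =
   (\big[addb/false]_(j in D | (j < i)%N) G i j) (+)
   (\big[addb/false]_(j in D | (i < j)%N) G i j).
  rewrite (bigID (fun j : 'I_n => j < i)) /=; congr (_ (+) _); apply: eq_bigl => j;
    by rewrite !inE -val_eqE /=; case: ltngtP => _; rewrite /= ?andbF ?andbT.
rewrite (eq_bigr _ (fun i _ => split_lt i)) big_split /=.
rewrite (exchange_big_dep (mem D)) /=; last by move=> i j _ /andP[].
rewrite -[X in _ = X](addbb (\big[addb/false]_(i in D) \big[addb/false]_(j in D | (i < j)%N) G i j)).
congr (_ (+) _); apply: eq_bigr => j jD.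
by apply: eq_big => [i|i _]; rewrite ?jD /=.
Qed.

(** Leibniz rule: when the product c over [s] is closed, the product of d(a_i) with c is d(a_i c),
    written as a sum over pairs of opposite facets. *)
Lemma cup_split i s D v :
  (forall D' w, #|D'| = (size s).+1 ->
     \big[addb/false]_(j in D') (cup s (D' :\ j) (inc w j) (+) cup s (D' :\ j) w) = false) ->
  #|D| = (size s).+1 ->
  cup (i :: s) D v = \big[addb/false]_(j in D)
    ((a i v && cup s (D :\ j) v) (+) (a i (inc v j) && cup s (D :\ j) (inc v j))).
Proof.
move=> closed_s cD /=.
have dist j : ((a i v (+) a i (inc v j)) && cup s (D :\ j) (inc v j)) =
  ((a i v && cup s (D :\ j) v) (+) (a i (inc v j) && cup s (D :\ j) (inc v j)))
  (+) (a i v && (cup s (D :\ j) (inc v j) (+) cup s (D :\ j) v)).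
  by case: (a i v); case: (a i _); case: (cup _ _ _); case: (cup _ _ _).
rewrite (eq_bigr _ (fun j _ => dist j)) big_split /= -big_distrr /= closed_s //.
by rewrite andbF addbF.
Qed.

Lemma inc_comm v i j : inc (inc v i) j = inc (inc v j) i.
Proof. by apply/ffunP => l; rewrite !ffunE -!addnA [X in _ + X]addnC. Qed.

(** By induction each facet term is itself a coboundary ([cup_split]), so the total is a double
    coboundary: a sum symmetric in the two removed directions. *)
Lemma cup_closed s D v : #|D| = (size s).+1 ->
  \big[addb/false]_(j in D) (cup s (D :\ j) (inc v j) (+) cup s (D :\ j) v) = false.
Proof.
elim: s D v => [|i s IHs] D v cD; first by rewrite big1.
have cDj j : j \in D -> #|D :\ j| = (size s).+1.
  by move=> jD; apply/eqP; rewrite -eqSS -cD (cardsD1 j D) jD.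
pose H l j w := a i w && cup s (D :\ j :\ l) w.
pose G j l := H l j (inc v j) (+) H l j (inc (inc v j) l) (+) (H l j v (+) H l j (inc v l)).
rewrite (eq_bigr (fun j => \big[addb/false]_(l in D :\ j) G j l)) => [|j jD].
  apply: addb_sym_sum => j l; rewrite /G /H finset.setDDl finset.setUC -finset.setDDl inc_comm.
  move: (_ && _) (_ && _) (_ && _) (_ && _) => b1 b2 b3 b4.
  by case: b1; case: b2; case: b3; case: b4.
by rewrite !cup_split ?cDj // -big_split.
Qed.

Lemma box_sum_ext s F G v :
  (forall w, (forall i, i \notin s -> w i = v i) -> F w = G w) ->
  box_sum s F v = box_sum s G v.
Proof.
elim: s v => [|i s IHs] v FG /=; first exact: FG.
apply: eq_bigr => c _; apply: IHs => w hw; apply: FG => j.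
rewrite inE negb_or => /andP[ji js]; by rewrite hw // ffunE (negPf ji).
Qed.

Lemma box_sum_add (I : finType) (P : pred I) s (F : I -> _ -> bool) v :
  box_sum s (fun w => \big[addb/false]_(i | P i) F i w) v =
  \big[addb/false]_(i | P i) box_sum s (F i) v.
Proof.
elim: s v => [|i s IHs] v //=.
by rewrite exchange_big /=; apply: eq_bigr => c _; rewrite IHs.
Qed.

Lemma box_sum_addb s F G v :
  box_sum s (fun w => F w (+) G w) v = box_sum s F v (+) box_sum s G v.
Proof.
elim: s v => [|i s IHs] v //=.
by rewrite -big_split /=; apply: eq_bigr => c _; rewrite IHs.
Qed.

Lemma box_sum0 s v : box_sum s (fun => false) v = false.
Proof. by elim: s v => //= i s IHs v; rewrite big1. Qed.

Lemma updC v i j c e : i != j -> upd (upd v i c) j e = upd (upd v j e) i c.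
Proof.
move=> ij; apply/ffunP => l; rewrite !ffunE.
by case: (eqVneq l j) => // ->; rewrite eq_sym (negPf ij).
Qed.

Lemma box_sum_rem i s F v : uniq s -> i \in s ->
  box_sum s F v = box_sum (i :: rem i s) F v.
Proof.
elim: s v => //= j s IHs v /andP[js us]; rewrite inE eq_sym.
case: (eqVneq j i) => [-> _ //|ji /= iS].
under eq_bigr => c _ do rewrite IHs //=.
rewrite exchange_big /=; apply: eq_bigr => c _; apply: eq_bigr => e _.
by rewrite updC // eq_sym.
Qed.

Lemma box_sum_inc i s F v : i \notin s ->
  box_sum s (fun w => F (inc w i)) v = box_sum s F (inc v i).
Proof.
elim: s v => //= j s IHs v; rewrite inE negb_or => /andP[ij iS].
apply: eq_bigr => c _; rewrite IHs //; congr box_sum; apply/ffunP => l.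
by rewrite !ffunE; case: (eqVneq l j) => // ->; rewrite eq_sym (negPf ij) addn0.
Qed.

Lemma telescope_addb m (f : nat -> bool) :
  \big[addb/false]_(c < m) (f c (+) f c.+1) = f 0 (+) f m.
Proof.
elim: m => [|m IHm]; first by rewrite big_ord0 addbb.
by rewrite big_ord_recr /= IHm addbA addbK.
Qed.

(** Discrete Stokes formula in direction [i]: only the two opposite faces of the box survive. *)
Lemma box_sum_telescope i s F v : uniq s -> i \in s ->
  box_sum s (fun w => F w (+) F (inc w i)) v =
  box_sum (rem i s) F (upd v i 0) (+) box_sum (rem i s) F (upd v i k).
Proof.
move=> us iS; have iN : i \notin rem i s by rewrite mem_rem_uniq // inE eqxx.
rewrite (box_sum_rem _ _ us iS) /=.
rewrite -(telescope_addb k (fun c => box_sum (rem i s) F (upd v i c))).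
apply: eq_bigr => c _; rewrite box_sum_addb box_sum_inc //; congr (_ (+) box_sum _ _ _).
by apply/ffunP => j; rewrite !ffunE; case: (eqVneq j i); rewrite ?addn1 ?addn0.
Qed.

Hypothesis a0 : forall i v, v i = 0 -> a i v = false.
Hypothesis ak : forall i v, v i = k -> a i v = true.

(** The label [i] is constant on the faces [v i = 0] and [v i = k] of the grid, so its coboundary, a
    factor of the product, vanishes on cubes inside them. *)
Lemma cup_face i s D v : i \in s -> i \notin D -> v i = 0 \/ v i = k ->
  cup s D v = false.
Proof.
elim: s D v => //= j s IHs D v; rewrite inE => /orP[/eqP<- {j}|iS] iD vi.
  rewrite big1 // => l lD; have li : (i == l) = false.
    by apply: contraNF iD => /eqP ->.
  have iv : inc v l i = v i by rewrite ffunE li addn0.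
  by case: vi => vi; [rewrite (a0 vi) (a0 (etrans iv vi))|rewrite (ak vi) (ak (etrans iv vi))].
rewrite big1 // => l lD; have li : (i == l) = false.
  by apply: contraNF iD => /eqP ->.
by rewrite IHs ?andbF // ?inE ?(negPf iD) ?andbF // ffunE li addn0.
Qed.

(** By [cup_split] the summand is a coboundary, so only the faces of the box count. Those in a
    direction of the tail [s] vanish by [cup_face], the face [v i = 0] vanishes because the label is
    false there, and the face [v i = k] reproduces the sum for [s], odd by induction. *)
Lemma box_sum_cup s v : uniq s -> box_sum s (cup s [set i in s]) v = true.
Proof.
elim: s v => // i s IHs v us; have /andP[iN us'] := us.
pose D := [set j in i :: s].
have cD : #|D| = (size s).+1 by rewrite cardsE (card_uniqP us).
pose H j w := a i w && cup s (D :\ j) w.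
rewrite (@box_sum_ext _ _ (fun w => \big[addb/false]_(j in D) (H j w (+) H j (inc w j)))); last first.
  by move=> w _; rewrite cup_split // => D' w' cD'; exact: cup_closed.
rewrite box_sum_add (bigD1 i) ?inE ?eqxx // big1 => [|j].
  rewrite Monoid.mulm1 (box_sum_telescope (H i)) ?mem_head //= eqxx.
  rewrite [X in X (+) _](@box_sum_ext _ _ (fun=> false)) => [|w hw]; last first.
    by rewrite /H a0 // hw // ffunE eqxx.
  rewrite box_sum0 addFb -[RHS](IHs (upd v i k) us').
  apply: box_sum_ext => w hw; rewrite /H ak ?hw // ?ffunE ?eqxx //=.
  congr cup; apply/setP => j; rewrite !inE; case: eqVneq => //= ->.
  by rewrite (negPf iN).
rewrite !inE => /andP[jD ji].
have js : j \in s by rewrite (negPf ji) in jD.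
rewrite (box_sum_telescope (H j)) //.
have zero c w : (c = 0 \/ c = k) -> w j = c -> box_sum (rem j (i :: s)) (H j) w = false.
  move=> hc wj; rewrite (@box_sum_ext _ _ (fun=> false)) ?box_sum0 // => u hu.
  rewrite /H (@cup_face j) ?andbF // ?inE ?eqxx //.
  by rewrite hu ?wj // mem_rem_uniq // inE eqxx.
by rewrite (zero 0) ?(zero k); auto; rewrite ffunE eqxx.
Qed.

(** A nonzero product contains a monotone path with one edge for each label, across which that label
    changes; the ends of this edge are the witnesses. *)
Lemma cup_witness s D v : cup s D v ->
  forall i, i \in s -> exists w w', [/\ a i w = false, a i w' = true,
    (forall j, v j <= w j <= v j + (j \in D)) &
    (forall j, v j <= w' j <= v j + (j \in D))].
Proof.
elim: s D v => //= i s IHs D v h.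
have [j jD /andP[aij cj]] : exists2 j, j \in D &
    (a i v (+) a i (inc v j)) && cup s (D :\ j) (inc v j).
  apply/exists_inP; apply: contraTT h => /exists_inPn hN.
  by rewrite big1 // => j jD; apply/negbTE/hN.
have vb l : v l <= v l <= v l + (l \in D) by rewrite leqnn leq_addr.
have ib l : v l <= inc v j l <= v l + (l \in D).
  by rewrite ffunE leq_addr leq_add2l; case: eqP => // ->; rewrite jD.
have cell w : (forall q, inc v j q <= w q <= inc v j q + (q \in D :\ j)) ->
    forall q, v q <= w q <= v q + (q \in D).
  move=> hw q; have := hw q; rewrite ffunE !inE => /andP[b1 b2].
  rewrite (leq_trans (leq_addr _ _) b1) (leq_trans b2) //.
  by case: eqVneq => [->|]; rewrite ?jD ?addn0.
move=> l; rewrite inE => /orP[/eqP ->|ls].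
  by case E: (a i v) aij => /=; case E': (a i _) => // _;
    [exists (inc v j), v | exists v, (inc v j)].
have [w [w' [h1 h2 /cell h3 /cell h4]]] := IHs _ _ cj _ ls.
by exists w, w'.
Qed.

Lemma box_sum_witness s F v : uniq s -> box_sum s F v ->
  exists w, [/\ F w, forall i, i \in s -> w i < k & forall i, i \notin s -> w i = v i].
Proof.
elim: s v => [|i s IHs] v /=; first by exists v.
move=> /andP[iN us] h.
have [c hc] : exists c : 'I_k, box_sum s F (upd v i c).
  apply/existsP; apply: contraTT h => /existsPn hN.
  by rewrite big1 // => c _; apply/negbTE/hN.
have [w [Fw ws wN]] := IHs _ us hc; exists w; split => // j.
  by rewrite inE => /orP[/eqP ->|/ws //]; rewrite wN // ffunE eqxx.
by rewrite inE negb_or => /andP[ji js]; rewrite wN // ffunE (negPf ji).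
Qed.

(** A cubical Sperner lemma: the sum over the whole grid is odd, so some unit cube has a nonzero
    product, and on it every label takes both values. *)
Lemma grid_cell : exists2 v : {ffun 'I_n -> nat}, forall i, v i < k &
  forall i, exists w w', [/\ a i w = false, a i w' = true,
    (forall j, v j <= w j <= (v j).+1) & (forall j, v j <= w' j <= (v j).+1)].
Proof.
have := box_sum_cup [ffun=> 0] (enum_uniq 'I_n).
move=> /(box_sum_witness (enum_uniq 'I_n))[v [cv vk _]].
exists v => [i|i]; first by rewrite vk ?mem_enum.
have [|w [w' [h1 h2 h3 h4]]] := cup_witness cv (i := i); first by rewrite mem_enum.
exists w, w'; split => // j; [have := h3 j | have := h4 j];
  by rewrite inE mem_enum addn1.
Qed.
End GridParity.

Local Open Scope classical_set_scope.
Local Open Scope ring_scope.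

(** * Zeros of maps close to the identity *)

Section EpsDelta.
Variable R : realType.

Lemma within_continuousP (V W : normedModType R) (A : set V) (f : V -> W) :
  {within A, continuous f} <->
  forall x, A x -> forall e, 0 < e -> exists2 d, 0 < d &
    forall y, A y -> `|y - x| < d -> `|f y - f x| < e.
Proof.
rewrite subspace_continuousP; split => cf x Ax.
  move=> e e0; have /cvgrPdist_lt/(_ e e0) := cf x Ax.
  rewrite near_withinE => /nbhs_ballP[d /= d0 hd]; exists d => // y Ay xy.
  by rewrite distrC; apply: hd => //; rewrite -ball_normE /ball_ /= distrC.
apply/cvgrPdist_lt => e e0; have [d d0 hd] := cf x Ax e e0.
rewrite near_withinE; apply/nbhs_ballP; exists d => //= y.
by rewrite -ball_normE /ball_ /= distrC => xy Ay; rewrite distrC; exact: hd.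
Qed.

Lemma open_normP (V : normedModType R) (A : set V) :
  open A <-> forall x, A x -> exists2 d, 0 < d & forall y, `|y - x| < d -> A y.
Proof.
rewrite openE; split => hA x Ax.
  have /nbhs_ballP[d /= d0 hd] := hA x Ax; exists d => // y xy.
  by apply: hd; rewrite -ball_normE /ball_ /= distrC.
have [d d0 hd] := hA x Ax; apply/nbhs_ballP; exists d => //= y.
by rewrite -ball_normE /ball_ /= distrC => /hd.
Qed.

Lemma closed_norm_ge (V : normedModType R) (c : V) r : closed [set x | r <= `|x - c|].
Proof.
rewrite -[X in closed X]setCK; apply/open_closedC/open_normP => x /= /negP.
rewrite -ltNge => xr; exists (r - `|x - c|); first by rewrite subr_gt0.
by move=> y yx; apply/negP; rewrite -ltNge; have := ler_distD x y c; lra.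
Qed.

Lemma compact_uniformly_continuous (V W : normedModType R) (A : set V) (f : V -> W) :
  compact A -> {within A, continuous f} ->
  forall e, 0 < e -> exists2 d, 0 < d &
    forall x y, A x -> A y -> `|y - x| < d -> `|f y - f x| < e.
Proof.
move=> cA /within_continuousP cf e e0.
have /near_covering_withinP nc : near_covering A by apply/compact_near_coveringP.
pose P (d : R) x := forall y, A y -> `|y - x| < d -> `|f y - f x| < e.
have nearP : \forall d \near 0^'+, A `<=` P d.
  apply: nc => x Ax; have [d d0 hd] := cf x Ax _ (divr_gt0 e0 (ltr0Sn R 1)).
  exists (ball x (d / 2), [set c | 0 < c < d / 2]) => /=.
    split; first by apply: nbhsx_ballx; rewrite divr_gt0.
    near=> c; apply/andP; split => //; near: c; apply: nbhs_right_lt.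
    by rewrite divr_gt0.
  move=> [x' c] /= [+ /andP[c0 cd]] Ax' y Ay yx'.
  rewrite -ball_normE /= distrC => xx'.
  have h1 := hd x' Ax' (lt_le_trans xx' _).
  have h2 : `|f x' - f x| < e / 2 by apply: h1; lra.
  have h3 : `|f y - f x| < e / 2.
    apply: hd => //; rewrite (le_lt_trans (ler_distD x' _ _)) //.
    by rewrite [ltRHS](splitr d) ltrD // (lt_trans yx').
  rewrite (le_lt_trans (ler_distD (f x) _ _)) // [ltRHS](splitr e) ltrD //.
  by rewrite distrC.
have [d [d0 hd]] : exists d : R, 0 < d /\ A `<=` P d.
  near (0 : R)^'+ => d; exists d; split; first by [].
  by near: d.
by exists d => // x y /hd; exact.
Unshelve. all: by end_near. Qed.

Lemma rv_coord_le n (x : 'rV[R]_n) i : `|x ord0 i| <= `|x|.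
Proof.
rewrite [leRHS]/Num.norm /= mx_normrE.
by apply: (le_bigmax _ (fun ij => `|x ij.1 ij.2|) (ord0, i)).
Qed.

Lemma rv_norm_le n (x : 'rV[R]_n) e : 0 <= e ->
  (forall i, `|x ord0 i| <= e) -> `|x| <= e.
Proof.
move=> e0 h; rewrite [leLHS]/Num.norm /= mx_normrE.
by apply: bigmax_le => // -[i j] _ /=; rewrite ord1.
Qed.

Lemma rv_norm_lt n (x : 'rV[R]_n) e : 0 < e ->
  (forall i, `|x ord0 i| < e) -> `|x| < e.
Proof.
move=> e0 h; rewrite [ltLHS]/Num.norm /= mx_normrE.
by apply: bigmax_lt => // -[i j] _ /=; rewrite ord1.
Qed.

Lemma compact_rv_ball n (c : 'rV[R]_n) e : compact [set x | `|x - c| <= e].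
Proof.
apply: bounded_closed_compact.
  exists (`|c| + e); split; first by rewrite num_real.
  move=> M hM x /= xc; rewrite ltW // (le_lt_trans _ hM) //.
  by rewrite -[x](subrK c) (le_trans (ler_normD _ _)) // [leLHS]addrC lerD2l.
rewrite -[X in closed X]setCK; apply/open_closedC/open_normP => x /= /negP.
rewrite -ltNge => xe; exists (`|x - c| - e); first by rewrite subr_gt0.
move=> y yx; apply/negP; rewrite -ltNge.
have := ler_distD y x c; have := distrC x y; lra.
Qed.

Lemma rv_norm_min n (F : 'rV[R]_n -> 'rV[R]_n) (A : set 'rV[R]_n) :
  compact A -> {within A, continuous F} -> (forall x, A x -> F x != 0) ->
  exists2 m, 0 < m & forall x, A x -> m <= `|F x|.
Proof.
move=> cA cF F0; have [[x0 Ax0]|A0] := pselect (A !=set0); last first.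
  by exists 1 => // x Ax; case: A0; exists x.
have [||c cA' hc] := @EVT_min_rV R n (fun x => `|F x|) A _ cA.
- by exists x0.
- move=> x; apply: continuous_comp; [exact: cF|exact: norm_continuous].
rewrite inE in cA'; exists `|F c|; first by rewrite normr_gt0 F0.
by move=> x Ax; apply: hc; rewrite inE.
Qed.

(** * A Brouwer-type zero theorem from the grid lemma *)

Section ZeroNearId.
Variables (n : nat) (F : 'rV[R]_n -> 'rV[R]_n).
Let Q : set 'rV[R]_n := [set x | `|x| <= 1].

Let pt k (v : {ffun 'I_n -> nat}) : 'rV[R]_n := \row_j ((v j)%:R * 2 / k%:R - 1).

(** The sign of the [i]-th coordinate of [F], overridden on the two faces normal to direction [i] to
    meet the boundary conditions of [grid_cell]. On those faces [|F x - x| <= 1] forces the matching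
    weak sign anyway. *)
Let label (k : nat) (i : 'I_n) (v : {ffun 'I_n -> nat}) := if v i == 0%N then false else if v i == k then true
  else 0 <= F (pt k v) ord0 i.

Let pt_in k (v : {ffun 'I_n -> nat}) : (0 < k)%N -> (forall j, v j <= k)%N -> Q (pt k v).
Proof.
move=> k0 vk; apply: rv_norm_le => // j; rewrite mxE ler_norml.
have k0' : 0 < k%:R :> R by rewrite ltr0n.
have : (v j)%:R <= k%:R :> R by rewrite ler_nat.
have : 0 <= (v j)%:R :> R by rewrite ler0n.
move: (v j)%:R => c c0 ck; have h0 : 0 <= c * 2 / k%:R by rewrite divr_ge0 ?mulr_ge0 // ltW.
have h2 : c * 2 / k%:R <= 2 by rewrite ler_pdivrMr //; lra.
by apply/andP; split; lra.
Qed.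

(* Brouwer's theorem for [x - F x], in the form that needs no self-map. *)
Lemma zero_near_id : {within Q, continuous F} ->
  (forall x, Q x -> `|F x - x| <= 1) -> exists2 x, Q x & F x = 0.
Proof.
move=> cF Fx; apply: contrapT => nz.
have cQ : compact Q.
  have -> : Q = [set x | `|x - 0| <= 1] by apply/funext => x; rewrite /= subr0.
  exact: compact_rv_ball.
have [|m m0 hm] := rv_norm_min cQ cF.
  by move=> x Qx; apply/eqP => Fx0; apply: nz; exists x.
have [d d0 hd] := compact_uniformly_continuous cQ cF m0.
(* The grid has mesh [2 / k < d], so on a cell [F] varies by less than the lower bound [m] of its
   norm. *)
pose k := (Num.truncn (2 / d)).+1.
have kd : 2 / k%:R < d.
  have : 2 / d < k%:R by rewrite truncnS_gt.
  by rewrite !ltr_pdivrMr ?ltr0n // mulrC.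
have k0 : 0 < k%:R :> R by rewrite ltr0n.
have labF i (v : {ffun 'I_n -> nat}) : v i = 0%N -> label k i v = false by rewrite /label => ->.
have labT i (v : {ffun 'I_n -> nat}) : v i = k -> label k i v = true by rewrite /label => ->; rewrite eqxx.
have [v vk hv] := grid_cell labF labT.
have Qv : Q (pt k v) by apply: pt_in => // j; rewrite ltnW.
have cell (w : {ffun 'I_n -> nat}) : (forall j, v j <= w j <= (v j).+1)%N ->
    (forall j, (w j <= k)%N) /\ `|F (pt k w) - F (pt k v)| < m.
  move=> hw; have wk j : (w j <= k)%N.
    by have /andP[_ /leq_trans] := hw j; apply.
  split=> //; apply: hd => //; first exact: pt_in.
  apply: rv_norm_lt => // j; apply: le_lt_trans kd.
  have /andP[h1 h2] := hw j.
  rewrite !mxE (_ : _ - _ = ((w j)%:R - (v j)%:R) * (2 / k%:R)); last by field; rewrite gt_eqF.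
  have k2 : 0 <= 2 / k%:R :> R by rewrite divr_ge0 // ltW.
  rewrite normrM [X in _ * X]ger0_norm // ler_piMl //.
  by rewrite ger0_norm ?subr_ge0 ?ler_nat // lerBlDl natr1 ler_nat.
have bound (w : {ffun 'I_n -> nat}) i : (forall j, (w j <= k)%N) -> `|F (pt k w) ord0 i - pt k w ord0 i| <= 1.
  move=> wk; have := rv_coord_le (F (pt k w) - pt k w) i; rewrite !mxE => /le_trans; apply.
  by apply: Fx; apply: pt_in.
(* On the cell found, each coordinate of [F] takes both weak signs, always within [m] of its value
   at the corner [v]; hence the norm at [v] is below [m]. *)
have : `|F (pt k v)| < m; last by apply/negP; rewrite -leNgt hm.
apply: rv_norm_lt => // i; have [w [w' [lw lw' /cell[wk cw] /cell[wk' cw']]]] := hv i.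
have Fw : F (pt k w) ord0 i <= 0.
  move: lw; rewrite /label; case: eqP => [w0 _|_].
    have := bound w i wk; rewrite mxE w0 !mul0r sub0r ler_norml; lra.
  by case: eqP => // _ /negbT; rewrite -ltNge => /ltW.
have Fw' : 0 <= F (pt k w') ord0 i.
  move: lw'; rewrite /label; case: eqP => // _; case: eqP => // wk1 _.
  have := bound w' i wk'; rewrite mxE wk1 mulrAC divff ?gt_eqF // ler_norml; lra.
have := le_lt_trans (rv_coord_le _ i) cw; have := le_lt_trans (rv_coord_le _ i) cw'.
rewrite !mxE !ltr_norml; lra.
Qed.

End ZeroNearId.
End EpsDelta.

(** * Invariance of domain *)

Section Extension.
Variables (R : realType) (n : nat).
Implicit Types (f g G : 'rV[R]_n -> 'rV[R]_n) (A K : set 'rV[R]_n).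

Lemma continuous_rowP (T : topologicalType) m (f : T -> 'rV[R]_m) :
  (forall i, continuous (fun x => f x ord0 i)) -> continuous f.
Proof.
move=> cf x; apply/cvgrPdist_lt => e e0.
have : \forall y \near x, forall i, `|f x ord0 i - f y ord0 i| < e.
  by apply: filter_forall => i; have /cvgrPdist_lt := cf i x; apply.
apply: filterS => y hy; apply: rv_norm_lt => // i; by rewrite !mxE.
Qed.

(** At distance at least [e] from [x0], compactness and injectivity give [|f x - f x0|] a positive
    lower bound, which serves as the modulus of continuity of the inverse at [f x0]. *)
Lemma compact_injective_inverse f A : compact A -> {within A, continuous f} ->
  {in A &, injective f} ->
  exists g, (forall x, A x -> g (f x) = x) /\ {within f @` A, continuous g}.
Proof.
move=> cA cf injf.
pose g y := xget 0 [set x | A x /\ f x = y].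
have gf x : A x -> g (f x) = x.
  move=> Ax; have [Ag fg] : A (g (f x)) /\ f (g (f x)) = f x.
    exact: (@xgetPex _ 0 [set z | A z /\ f z = f x] (ex_intro _ x (conj Ax erefl))).
  by apply: injf; rewrite ?inE.
exists g; split => //; apply/within_continuousP => _ [x0 Ax0 <-] e e0.
pose B := A `&` [set x | e <= `|x - x0|].
have cB : compact B.
  by apply: compact_closedI => //; exact: closed_norm_ge.
have cF : {within B, continuous (fun x => f x - f x0)}.
  apply: (@continuous_subspaceW _ _ _ A); first by move=> x [].
  by move=> x; apply: cvgB; [exact: cf|exact: cvg_cst].
have [|m m0 hm] := rv_norm_min cB cF.
  move=> x [Ax /= ex]; rewrite subr_eq0; apply/eqP => /injf.
  rewrite !inE => /(_ Ax Ax0) xx; move: ex; rewrite xx subrr normr0; lra.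
exists m => // _ [x Ax <-]; rewrite !gf // => fm; rewrite ltNge; apply/negP => ex.
by have := hm x (conj Ax ex); rewrite leNgt fm.
Qed.

(** Scalar Tietze extension in each coordinate; the sup norm keeps the bound 1. *)
Lemma tietze_rV g K : compact K -> {within K, continuous g} ->
  (forall x, K x -> `|g x| <= 1) ->
  exists G, [/\ forall x, K x -> G x = g x, continuous G & forall x, `|G x| <= 1].
Proof.
move=> cK cg g1.
have clK : closed K by apply: compact_closed => //; exact: norm_hausdorff.
have /choice[Gi hGi] : forall i : 'I_n, exists h : 'rV[R]_n -> R^o,
    [/\ {in K, (fun x => g x ord0 i : R^o) =1 h}, continuous h & forall x, `|h x| <= 1].
  move=> i; apply: continuous_bounded_extension => //.
  - exact: pseudometric_normal.
  - move=> x; apply: (cvg_comp g (fun M : 'rV[R]_n => M ord0 i) (cg x)).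
    exact: coord_continuous.
  - by move=> x Kx; rewrite (le_trans (rv_coord_le _ _)) ?g1.
exists (fun x => \row_i Gi i x); split.
- move=> x Kx; apply/rowP => i; rewrite mxE; have [h _ _] := hGi i.
  by rewrite -h ?inE.
- apply: continuous_rowP => i; rewrite (_ : (fun x => _) = Gi i).
    by have [] := hGi i.
  by apply/funext => x; rewrite mxE.
- move=> x; apply: rv_norm_le => // i; rewrite mxE; by have [] := hGi i.
Qed.

(* Each coordinate is approximated by its inf-convolution with [L * norm]. *)
Lemma lipschitz_approximation G K (y0 : 'rV[R]_n) : compact K -> K y0 -> continuous G ->
  (forall x, `|G x| <= 1) -> forall e, 0 < e ->
  exists (P : 'rV[R]_n -> 'rV[R]_n) (L : R), [/\ 0 < L,
    forall x y, `|P x - P y| <= L * `|x - y| &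
    forall x, K x -> `|P x - G x| <= e].
Proof.
move=> cK Ky0 cG G1 e e0.
have [d d0 hd] := compact_uniformly_continuous cK (continuous_subspaceT cG) e0.
have G1' i x : - 1 <= G x ord0 i <= 1.
  by rewrite -ler_norml (le_trans (rv_coord_le _ _)).
(* With this slope a point [z] at distance at least [d] from [y] pays at least 2, the largest
   oscillation a coordinate of [G] can have, so it cannot push the infimum below the value at
   [y]. *)
pose L := 2 / d; have L0 : 0 < L by rewrite divr_gt0.
pose S i y := [set G z ord0 i + L * `|y - z| | z in K].
have S0 i y : S i y !=set0 by exists (G y0 ord0 i + L * `|y - y0|), y0.
have lbS i y : has_lbound (S i y).
  exists (-1) => _ [z Kz <-]; have /andP[+ _] := G1' i z.
  have : 0 <= L * `|y - z| by rewrite mulr_ge0 // ltW.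
  lra.
pose P y : 'rV[R]_n := \row_i inf (S i y).
have lip i y y' : inf (S i y) - inf (S i y') <= L * `|y - y'|.
  rewrite lerBlDl -lerBlDr; apply: lb_le_inf => // _ [z Kz <-].
  rewrite lerBlDr; apply: le_trans (ge_inf (lbS i y) _) _; first by exists z.
  rewrite -addrA lerD2l -mulrDr ler_wpM2l ?(ltW L0) // [leRHS]addrC.
  exact: ler_distD.
exists P, L; split => // [y y'|y Ky].
  apply: rv_norm_le => [|i]; first by rewrite mulr_ge0 // ltW.
  by rewrite !mxE ler_norml lip andbT lerNl opprB distrC lip.
apply: rv_norm_le => [|i]; first exact: ltW.
rewrite !mxE ler_norml; apply/andP; split.
  rewrite lerBrDl; apply: lb_le_inf => // _ [z Kz <-].
  have [yz|yz] := ltP `|z - y| d.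
    have := le_lt_trans (rv_coord_le _ i) (hd y z Ky Kz yz); rewrite !mxE ltr_norml.
    have : 0 <= L * `|y - z| by rewrite mulr_ge0 // ltW.
    lra.
  have : 2 <= L * `|y - z|.
    by rewrite distrC mulrAC ler_pdivlMr // ler_pM2l.
  have := G1' i y; have := G1' i z; lra.
rewrite lerBlDr; apply: le_trans (ge_inf (lbS i y) _) _; first by exists y.
by rewrite subrr normr0 mulr0 addr0 lerDr ltW.
Qed.
End Extension.

(** * Small values missed by a Lipschitz map on a sphere *)

Section Avoid.
Variables (R : realType).

(* Counting: the sphere meets [2 n.+1 N^n] cells of a grid of mesh [1/N],
   each of which [P] sends near at most one of [N^n.+1] separated points. *)
Lemma lipschitz_sphere_avoid n (P : 'rV[R]_n.+1 -> 'rV[R]_n.+1) (L : R) c r e :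
  0 < L -> 0 < r -> 0 < e -> (forall x y, `|P x - P y| <= L * `|x - y|) ->
  exists2 w, `|w| < e & forall y, `|y - c| = r -> P y != w.
Proof.
move=> L0 r0 e0 lipP; apply: contrapT => Nw.
(* [C] makes the image of a cell of width [2 r / N] smaller than the spacing [e / 2 / M] of the
   points [pt a]; [M] makes these points more numerous than the cells. *)
pose C := (Num.truncn (4 * r * L / e)).+1.
have hC : 4 * r * L / e < C%:R by rewrite truncnS_gt.
pose M := (2 * n.+1 * (2 * C) ^ n).+1.
pose N := (C * M)%N.
pose pt (a : {ffun 'I_n.+1 -> 'I_M}) : 'rV[R]_n.+1 := \row_i (e / 2 * (a i)%:R / M%:R).
have M0 : 0 < M%:R :> R by rewrite ltr0n.
have C0 : 0 < C%:R :> R by rewrite ltr0n.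
have N0 : 0 < N%:R :> R by rewrite natrM mulr_gt0.
have ptlt a : `|pt a| < e.
  apply: rv_norm_lt => // i; rewrite mxE ger0_norm; last first.
    by rewrite divr_ge0 ?mulr_ge0 // ltW.
  rewrite ltr_pdivrMr //; have aM : (a i)%:R < M%:R :> R by rewrite ltr_nat.
  have a0 : 0 <= (a i)%:R :> R by rewrite ler0n.
  nra.
have /choice[Y hY] : forall a, exists y, `|y - c| = r /\ P y = pt a.
  move=> a; apply: contrapT => Ny; apply: Nw; exists (pt a) => // y yc.
  by apply/eqP => Py; apply: Ny; exists y.
have /choice[I hI] : forall a, exists i : 'I_n.+1, `|Y a ord0 i - c ord0 i| = r.
  move=> a; apply: contrapT => Ni; have [Yr _] := hY a.
  suff : `|Y a - c| < r by rewrite Yr ltxx.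
  apply: rv_norm_lt => // i; rewrite lt_neqAle; apply/andP; split; last first.
    by rewrite -Yr; exact: rv_coord_le.
  by apply/eqP; rewrite !mxE => h; apply: Ni; exists i.
pose t a j := (Y a ord0 j - c ord0 j + r) / (2 * r) * N%:R.
have t_bd a j : 0 <= t a j <= N%:R.
  have := rv_coord_le (Y a - c) j; have [-> _] := hY a; rewrite !mxE ler_norml => /andP[h1 h2].
  rewrite mulr_ge0 ?ler_piMl ?(ltW N0) //; rewrite ?ler_pdivrMr ?divr_ge0 //; lra.
(* A cell is a face of the cube, given by a coordinate and a sign, together with the integer parts
   of the other rescaled coordinates. The value [N] may be attained, hence ['I_N.+1]. *)
pose cell a : 'I_n.+1 * bool * {ffun 'I_n -> 'I_N.+1} :=
  (I a, 0 <= Y a ord0 (I a) - c ord0 (I a),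
   [ffun j => inord (Num.truncn (t a (lift (I a) j)))]).
have cell_inj : injective cell.
  move=> a b [Iab sab /ffunP tab].
  have Yab j : `|Y a ord0 j - Y b ord0 j| <= 2 * r / N%:R.
    have [->|] := eqVneq j (I a); last rewrite eq_sym => jI.
      have := hI a; have := hI b; move: sab; rewrite -Iab.
      set u := Y a _ _ - _; set v := Y b _ _ - _.
      have -> : Y a ord0 (I a) - Y b ord0 (I a) = u - v by rewrite /u /v; ring.
      move=> sab hv hu; have -> : u = v.
        have [u0|u0] := lerP 0 u; move: sab hu hv.
          by rewrite u0 => /esym v0; rewrite !ger0_norm // => -> ->.
        rewrite leNgt u0 => /esym/negbT; rewrite -ltNge => v0.
        by rewrite !ltr0_norm // => hu hv; lra.
      by rewrite subrr normr0 divr_ge0 // ?mulr_ge0 // ltW.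
    have [l lj _] := unlift_some jI.
    have := tab l; rewrite !ffunE -Iab -lj => /(congr1 val).
    have tN x : 0 <= t x j <= N%:R -> (Num.truncn (t x j) < N.+1)%N.
      move=> /andP[x0 xN]; rewrite ltnS -(ler_nat R) (le_trans _ xN) //.
      by rewrite truncn_le.
    rewrite /= !inordK ?tN // => tt.
    have /andP[ta0 _] := t_bd a j; have /andP[tb0 _] := t_bd b j.
    have /andP[] := truncn_itv ta0; have /andP[] := truncn_itv tb0.
    rewrite tt -natr1 => h1 h2 h3 h4.
    have : `|t a j - t b j| <= 1 by rewrite ler_norml; lra.
    rewrite (_ : t a j - t b j = (Y a ord0 j - Y b ord0 j) * (N%:R / (2 * r))); last first.
      by rewrite /t; field; lra.
    rewrite normrM [X in _ * X]gtr0_norm ?divr_gt0 ?mulr_gt0 //.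
    by rewrite -ler_pdivlMr ?divr_gt0 ?mulr_gt0 // invf_div mul1r.
  have Pab : `|pt a - pt b| <= L * (2 * r / N%:R).
    have [_ <-] := hY a; have [_ <-] := hY b; apply: le_trans (lipP _ _) _.
    rewrite ler_wpM2l ?(ltW L0) //; apply: rv_norm_le => [|i].
      by rewrite divr_ge0 // ?mulr_ge0 // ltW.
    by rewrite !mxE.
  have small : L * (2 * r / N%:R) < e / 2 / M%:R.
    rewrite /N natrM; have hC' : 4 * r * L < C%:R * e by rewrite -ltr_pdivrMr.
    rewrite (_ : L * _ = 2 * r * L / C%:R / M%:R); last by field; lra.
    by rewrite ltr_pM2r ?invr_gt0 // ltr_pdivrMr //; lra.
  apply/ffunP => i; apply/eqP; apply: contraTT isT => abi.
  have : `|(pt a - pt b) ord0 i| < e / 2 / M%:R.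
    exact: le_lt_trans (rv_coord_le _ _) (le_lt_trans Pab small).
  rewrite !mxE (_ : _ - _ = ((a i)%:R - (b i)%:R) * (e / 2 / M%:R)); last by field; lra.
  rewrite normrM [X in _ * X]gtr0_norm ?divr_gt0 // gtr_pMl ?divr_gt0 //.
  have : 1 <= `|(a i)%:R - (b i)%:R| :> R; last by lra.
  move: abi; rewrite -val_eqE neq_lt => /orP[] h.
    by rewrite ler_normr; apply/orP; right; rewrite opprB lerBrDl natr1 ler_nat.
  by rewrite ler_normr; apply/orP; left; rewrite lerBrDl natr1 ler_nat.
(* Pigeonhole: M^(n+1) points against 2 (n+1) (N+1)^n cells, where N + 1 <= 2 C M. *)
have := leq_card cell cell_inj.
rewrite !card_prod card_bool !card_ffun !card_ord.
have NM : (N.+1 <= 2 * C * M)%N by rewrite -mulnA mul2n -addnn -addn1 leq_add2l muln_gt0.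
apply/negP; rewrite -ltnNge.
have NMn : (N.+1 ^ n <= (2 * C) ^ n * M ^ n)%N.
  by rewrite -expnMn; case: (n) => // m; rewrite leq_exp2r.
apply: leq_ltn_trans (leq_mul (leqnn _) NMn) _.
by rewrite mulnA expnS ltn_pmul2r ?expn_gt0 // [(n.+1 * 2)%N]mulnC.
Qed.
End Avoid.

(** * Invariance of domain and of dimension *)

Section InvarianceOfDomain.
Variable R : realType.

Lemma norm_radial (V : normedModType R) (r : R) (y : V) : 0 < r -> y != 0 -> `|y| <= r ->
  `|Num.max (r / `|y|) 1 *: y| = r.
Proof.
move=> r0 y0 yr; have ny : 0 < `|y| by rewrite normr_gt0.
rewrite max_l; last by rewrite ler_pdivlMr ?mul1r.
by rewrite normrZ ger0_norm ?divr_ge0 ?(ltW r0) // divfK // gt_eqF.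
Qed.

(** The map pushes the punctured ball about [c] radially onto its sphere and fixes everything
    outside. Continuity off [c] suffices, as [c] will be a value missed by [f]. *)
Lemma radial_continuous (V : normedModType R) (r : R) (c y : V) : y - c != 0 ->
  {for y, continuous (fun z => c + Num.max (r / `|z - c|) 1 *: (z - c))}.
Proof.
move=> yc; have cB : z - c @[z --> y] --> y - c.
  by apply: cvgB; [exact: cvg_id|exact: cvg_cst].
apply: cvgD; first exact: cvg_cst.
apply: cvgZ => //.
have cq : {for y, continuous (fun z => r / `|z - c| : R^o)}.
  apply: cvgM; first exact: cvg_cst.
  by apply: cvgV; [rewrite normr_eq0|exact: cvg_norm].
have c1 : {for y, continuous (cst 1 : V -> R^o)} by exact: cvg_cst.
exact: (continuous_max cq c1).
Qed.

(** Otherwise a value [c] near [f 0] is missed. Let [G] extend the inverse of [f], let [P] be a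
    Lipschitz approximation of [G], and let [Phi] be the radial map about [c]. For a small [w]
    missed by [P] on the sphere, [P (Phi (f x)) - w] has no zero: outside the ball [G] is bounded
    away from 0, and inside [Phi] lands on the sphere. Yet this map is close to the identity,
    against [zero_near_id]. *)
Lemma invariance_of_domain_cube n (f : 'rV[R]_n -> 'rV[R]_n) :
  {within [set x | `|x| <= 1], continuous f} ->
  {in [set x | `|x| <= 1] &, injective f} ->
  exists2 e, 0 < e & forall y, `|y - f 0| < e -> exists2 x, `|x| <= 1 & f x = y.
Proof.
case: n f => [|n] f cf injf.
  (* In dimension 0 the space is a point; avoiding the sphere needs positive dimension. *)
  exists 1 => // y _; exists 0; first by rewrite normr0.
  by rewrite [LHS]thinmx0 [RHS]thinmx0.
set Q : set 'rV[R]_n.+1 := [set x | `|x| <= 1].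
have cQ : compact Q.
  have -> : Q = [set x | `|x - 0| <= 1] by apply/funext => x; rewrite /= subr0.
  exact: compact_rv_ball.
have Q0 : Q 0 by rewrite /Q /= normr0.
apply: contrapT => Ne.
have [g [gf cg]] := compact_injective_inverse cQ cf injf.
pose K := f @` Q; have cK : compact K by exact: continuous_compact.
have g1 y : K y -> `|g y| <= 1 by move=> [x Qx <-]; rewrite gf.
have [G [GK cG G1]] := tietze_rV cK cg g1.
have GfE x : Q x -> G (f x) = x by move=> Qx; rewrite GK ?gf //; exists x.
have /within_continuousP cG' := continuous_subspaceT (A := setT) cG.
have [|d d0 hd] := cG' (f 0) I (1 / 4); first by lra.
have Gsmall y : `|y - f 0| < d -> `|G y| < 1 / 4.
  by move=> /hd; rewrite (GfE _ Q0) subr0; apply.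
(* A ball of radius [r] about a centre within [r] of [f 0] stays in the [d]-ball, where
   [|G| < 1 / 4]. *)
pose r := d / 2; have r0 : 0 < r by rewrite divr_gt0.
have [c [cr Kc]] : exists c, `|c - f 0| < r /\ ~ K c.
  apply: contrapT => Nc; apply: Ne; exists r => // y yr.
  by apply: contrapT => Ny; apply: Nc; exists y; split => // -[x Qx fx]; apply: Ny; exists x.
have cball y : `|y - c| <= r -> `|y - f 0| < d.
  move=> yc; have := ler_distD c y (f 0); have -> : d = r + r by rewrite /r; lra.
  lra.
pose S1 := K `&` [set y | r <= `|y - c|].
have cS1 : compact S1.
  by apply: compact_closedI => //; exact: closed_norm_ge.
have [|m m0 hm] := rv_norm_min cS1 (continuous_subspaceT cG).
  move=> _ [[x Qx <-] /= xr]; rewrite GfE //; apply: contraTneq xr => ->.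
  by rewrite -ltNge distrC.
(* The ball is added because [Phi] may move points out of [K], and [P] must approximate [G] there
   too. *)
pose K' := K `|` [set y | `|y - c| <= r].
have cK' : compact K' by apply: compactU => //; exact: compact_rv_ball.
(* [e <= m / 4] excludes zeros outside the ball; [e <= 1 / 16] keeps the perturbed map within 1 of
   the identity. *)
pose e := Num.min m (1 / 4) / 4.
have e0 : 0 < e by rewrite divr_gt0 // lt_min m0 /=; lra.
have em : e <= m / 4 by rewrite ler_pM2r ?invr_gt0 // ge_min lexx.
have e4 : e <= 1 / 16.
  have : Num.min m (1 / 4) <= 1 / 4 by rewrite ge_min lexx orbT.
  by rewrite /e; lra.
have K'f0 : K' (f 0) by left; exists 0.
have [P [L [L0 lipP PG]]] := lipschitz_approximation cK' K'f0 cG G1 e0.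
have [w we Pw] := lipschitz_sphere_avoid c L0 r0 e0 lipP.
pose Phi y := c + Num.max (r / `|y - c|) 1 *: (y - c).
have fc x : Q x -> f x - c != 0.
  by move=> Qx; rewrite subr_eq0; apply: contra_notN Kc => /eqP <-; exists x.
have cP : continuous P.
  apply/continuous_subspace_setT/within_continuousP => x _ e' e'0.
  exists (e' / L); first by rewrite divr_gt0.
  by move=> y _; rewrite ltr_pdivlMr // mulrC; apply: le_lt_trans.
have cPhi (y : 'rV[R]_n.+1) : y - c != 0 -> {for y, continuous Phi}.
  exact: radial_continuous.
have cF : {within Q, continuous (fun x => P (Phi (f x)) - w)}.
  rewrite continuous_subspace_in => x; rewrite inE => Qx.
  apply: cvgB; last exact: cvg_cst.
  apply: (cvg_comp _ P _ (cP _)); exact: (cvg_comp _ Phi (cf x) (cPhi _ (fc _ Qx))).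
have Phi_out y : K y -> r <= `|y - c| -> Phi y = y.
  move=> Ky ry; have y0 : 0 < `|y - c| by exact: lt_le_trans ry.
  rewrite /Phi max_r ?scale1r; first by rewrite addrC subrK.
  by rewrite ler_pdivrMr ?mul1r.
have Phi_in x : Q x -> `|f x - c| <= r -> `|Phi (f x) - c| = r.
  by move=> Qx hx; rewrite /Phi addrC addKr norm_radial ?fc.
have [|x Qx Fx0] := zero_near_id cF; last first.
- have Kfx : K (f x) by exists x.
  have [xr|xr] := leP r `|f x - c|; last first.
    by move/eqP: Fx0; rewrite subr_eq0; apply/negP; apply: Pw; apply: Phi_in => //; exact: ltW.
  move: Fx0; rewrite Phi_out // => Fx0.
  have h1 := hm _ (conj Kfx xr); have h2 := PG _ (or_introl Kfx).
  have : `|G (f x)| <= `|G (f x) - P (f x)| + `|P (f x) - w| + `|w|.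
    by rewrite -{1}(subrK w (G (f x))) (le_trans (ler_normD _ _)) // lerD2r ler_distD.
  rewrite Fx0 normr0 distrC; lra.
- move=> x Qx; have Kfx : K (f x) by exists x.
  have tri z : K' z -> `|P z - w - G z| <= 2 * e.
    move=> /PG hz; rewrite addrAC; apply: le_trans (ler_normB _ _) _; lra.
  have [xr|xr] := leP r `|f x - c|.
    rewrite Phi_out // -{2}[x]GfE //.
    by have := tri _ (or_introl Kfx); lra.
  have hP := Phi_in _ Qx (ltW xr).
  have PhiK : `|Phi (f x) - c| <= r by rewrite hP.
  have h1 := tri _ (or_intror PhiK).
  have h2 := Gsmall _ (cball _ PhiK); have := Gsmall _ (cball _ (ltW xr)).
  rewrite GfE // => h3; have t1 := ler_distD (G (Phi (f x))) (P (Phi (f x)) - w) x.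
  have t2 := ler_normB (G (Phi (f x))) x; lra.
Qed.

Theorem invariance_of_domain n (U : set 'rV[R]_n) (f : 'rV[R]_n -> 'rV[R]_n) :
  open U -> {within U, continuous f} -> {in U &, injective f} -> open (f @` U).
Proof.
move=> oU cf injf; apply/open_normP => _ [x0 Ux0 <-].
have [d d0 hd] := (open_normP U).1 oU x0 Ux0.
pose q := d / 2; have q0 : 0 < q by rewrite divr_gt0.
pose h (x : 'rV[R]_n) := x0 + q *: x.
have Uh x : `|x| <= 1 -> U (h x).
  move=> x1; apply: hd; rewrite /h addrC addKr normrZ gtr0_norm //.
  by rewrite (@le_lt_trans _ _ q) ?ler_piMr ?(ltW q0) // /q; lra.
have [||e e0 he] := @invariance_of_domain_cube n (f \o h).
- apply/within_continuousP => x /Uh Ux e e0.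
  have [d' d'0 hd'] := (within_continuousP U f).1 cf _ Ux e e0.
  exists (d' / q); first by rewrite divr_gt0.
  move=> y /Uh Uy; rewrite ltr_pdivlMr // => yx; apply: hd' => //.
  by rewrite /h opprD addrACA subrr add0r -scalerBr normrZ gtr0_norm // mulrC.
- move=> x y; rewrite !inE => /Uh Ux /Uh Uy /= /injf; rewrite !inE => /(_ Ux Uy).
  by move/addrI/(scalerI (lt0r_neq0 q0)).
exists e => // y; have -> : f x0 = (f \o h) 0 by rewrite /= /h scaler0 addr0.
by move=> /he[x /Uh Ux <-]; exists (h x).
Qed.

(** If n < m, padding [f] with zeros gives an injective map whose image is open in R^m and yet lies
    in a hyperplane. *)
Theorem invariance_of_dimension m n (U : set 'rV[R]_m) (f : 'rV[R]_m -> 'rV[R]_n) :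
  open U -> U !=set0 -> {within U, continuous f} -> {in U &, injective f} -> (m <= n)%N.
Proof.
move=> oU [x0 Ux0] cf injf; rewrite leqNgt; apply/negP => nm.
pose g (x : 'rV[R]_m) : 'rV[R]_m := \row_i if insub (i : nat) is Some j then f x ord0 j else 0.
have cg : {within U, continuous g}.
  apply: continuous_rowP => i; rewrite /g.
  case E : (@insub nat (fun k => k < n)%N 'I_n i) => [j|].
    rewrite (_ : (fun x => _) = (fun x => f x ord0 j)).
      move=> x; apply: (cvg_comp f (fun M : 'rV[R]_n => M ord0 j) (cf x)).
      exact: coord_continuous.
    by apply/funext => x; rewrite mxE E.
  rewrite (_ : (fun x => _) = cst 0); first exact: cst_continuous.
  by apply/funext => x; rewrite mxE E.
have injg : {in U &, injective g}.
  move=> x y Ux Uy /rowP gxy; apply: injf => //; apply/rowP => j.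
  have := gxy (widen_ord (ltnW nm) j); rewrite !mxE /= insubT //= => jn.
  by rewrite (_ : Sub _ _ = j) //; exact: val_inj.
have [d d0 hd] := (open_normP _).1 (invariance_of_domain oU cg injg) _ (ex_intro2 _ _ x0 Ux0 erefl).
pose y := g x0 + \row_i (if i == Ordinal nm then d / 2 else 0).
have [|x _ gx] := hd y.
  rewrite /y addrC addKr; apply: rv_norm_lt => // i; rewrite mxE.
  by case: ifP => _; rewrite ?normr0 // gtr0_norm ?divr_gt0 //; lra.
move/rowP: gx => /(_ (Ordinal nm)); rewrite /y !mxE eqxx /= insubF ?ltnn // add0r; lra.
Qed.
End InvarianceOfDomain.

(** * Power sums and interlacing root vectors *)

Section NewtonIdentities.
Variable F : fieldType.

Definition power_sum (rs : seq F) k := \sum_(r <- rs) r ^+ k.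

Lemma deriv_prod_XsubC (rs : seq F) :
  (\prod_(r <- rs) ('X - r%:P))^`() =
  \sum_(r <- rs) (\prod_(r <- rs) ('X - r%:P) %/ ('X - r%:P)).
Proof.
elim: rs => [|a rs IHrs]; first by rewrite !big_nil derivC.
rewrite !big_cons derivM derivXsubC mul1r IHrs mulKp ?polyXsubC_eq0 //.
congr (_ + _); rewrite mulr_sumr; apply: eq_big_seq => r rs_r.
by rewrite divp_mulA // dvdp_XsubCl root_prod_XsubC.
Qed.

(** Multiply h' = sum of h / (X - r) by X^(k+1) and expand X^(k+1) - r^(k+1) as a geometric sum. The
    remainders r^(k+1) h / (X - r) have degree below d, so they vanish on comparing coefficients of
    X^d. *)
Lemma newton_identity (rs : seq F) k (h := \prod_(r <- rs) ('X - r%:P)) :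
  (k <= size rs)%N ->
  h`_(size rs - k) *+ (size rs - k) =
  \sum_(m < k.+1) power_sum rs m * h`_(size rs - (k - m)).
Proof.
move=> kd; set d := size rs.
have quot r : r \in rs -> (h %/ ('X - r%:P)) * 'X^(k.+1) =
    h * \sum_(m < k.+1) r%:P ^+ m * 'X^(k - m) + (h %/ ('X - r%:P)) * r%:P ^+ k.+1.
  move=> rr; have hq : h %/ ('X - r%:P) * ('X - r%:P) = h.
    by rewrite divpK // dvdp_XsubCl root_prod_XsubC.
  rewrite -{2}hq -mulrA -mulrDr; congr (_ * _).
  rewrite -[LHS](subrK (r%:P ^+ k.+1)) subrXX; congr (_ * _ + _).
  by apply: eq_bigr => i _; rewrite mulrC.
have /(congr1 (coefp d)) : h^`() * 'X^(k.+1) = h * \sum_(m < k.+1) (power_sum rs m)%:P * 'X^(k - m)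
   + \sum_(r <- rs) (h %/ ('X - r%:P)) * r%:P ^+ k.+1.
  rewrite deriv_prod_XsubC mulr_suml (eq_big_seq _ quot) big_split /=.
  congr (_ + _); rewrite -mulr_sumr; congr (_ * _).
  rewrite exchange_big; apply: eq_bigr => m _; rewrite -mulr_suml; congr (_ * _).
  by rewrite /power_sum rmorph_sum; apply: eq_bigr => r _; rewrite rmorphXn.
rewrite /= coefD coefMXn coef_deriv [X in _ = _ + X](_ : _ = 0) ?addr0; last first.
  rewrite coef_sum big_seq big1 // => r rr; apply: nth_default.
  rewrite -rmorphXn /= mulrC mul_polyC (leq_trans (size_scale_leq _ _)) //.
  by rewrite size_divp ?polyXsubC_eq0 // size_XsubC size_prod_XsubC subn1.
rewrite mulr_sumr coef_sum => E.
have -> : \sum_(m < k.+1) power_sum rs m * h`_(d - (k - m)) =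
    \sum_(m < k.+1) (h * ((power_sum rs m)%:P * 'X^(k - m)))`_d.
  apply: eq_bigr => m _; rewrite mulrCA coefCM coefMXn ifN //.
  by rewrite -leqNgt (leq_trans (leq_subr _ _)).
rewrite -E; case: ltnP => [dk|kd']; last by rewrite subnSK.
by rewrite (_ : (d - k)%N = 0%N) ?mulr0n //; apply/eqP; rewrite subn_eq0 -ltnS.
Qed.
End NewtonIdentities.

Section NewtonCompare.
Variable F : numFieldType.

Lemma newton_step (rs : seq F) k (h := \prod_(r <- rs) ('X - r%:P)) :
  (k < size rs)%N ->
  power_sum rs k.+1 = - (k.+1%:R * h`_(size rs - k.+1)) -
  \sum_(m < k) power_sum rs m.+1 * h`_(size rs - (k - m)).
Proof.
move=> kd; have := newton_identity kd; rewrite big_ord_recl big_ord_recr /=.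
rewrite -/h subn0 subnn subn0.
have -> : power_sum rs 0 = (size rs)%:R.
  by rewrite /power_sum; under eq_bigr do rewrite expr0; rewrite big_const_seq count_predT iter_addr_0.
have -> : h`_(size rs) = 1.
  have /monicP := monic_prod_XsubC rs xpredT id.
  by rewrite /lead_coef size_prod_XsubC.
rewrite mulr1 -[LHS]mulr_natl natrB // => E.
rewrite (eq_bigr (fun i : 'I_k => power_sum rs i.+1 * h`_(size rs - (k - i)))) in E; last first.
  by move=> i _; rewrite /bump /= add1n subSS.
rewrite /bump leq0n add1n in E; move: E.
set S := \sum_(_ < k) _; set c := h`_ _; set p := power_sum _ _; set e := (size rs)%:R => E.
have -> : p = e * c + (S + p) - e * c - S by ring.
by rewrite -E; ring.
Qed.

(** Newton's recursion is triangular: the first coefficients determine the first power sums, and the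
    next power sum moves against the next coefficient. The minus sign is what reverses the
    inequality from [weighted_sum_wall] to [stratum_poly_wall]. *)
Lemma power_sum_coef (rs rs' : seq F) K
    (h := \prod_(r <- rs) ('X - r%:P)) (h' := \prod_(r <- rs') ('X - r%:P)) :
  size rs = size rs' -> (K <= size rs)%N ->
  (forall j, (0 < j <= K)%N -> h`_(size rs - j) = h'`_(size rs - j)) ->
  (forall j, (0 < j <= K)%N -> power_sum rs j = power_sum rs' j) /\
  ((K < size rs)%N -> power_sum rs K.+1 - power_sum rs' K.+1 =
    - (K.+1%:R * (h`_(size rs - K.+1) - h'`_(size rs - K.+1)))).
Proof.
move=> eqs; elim: K => [|K IHK] Kd hh'.
  split; first by case.
  by move=> d0; rewrite !newton_step -?eqs // !big_ord0 -/h -/h'; ring.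
have [|ps step] := IHK (ltnW Kd).
  by move=> j /andP[j0 jK]; apply: hh'; rewrite j0 ltnW.
have psK j : (0 < j <= K.+1)%N -> power_sum rs j = power_sum rs' j.
  rewrite [(j <= _)%N]leq_eqVlt ltnS => /andP[j0 /orP[/eqP ->|jK]]; last by rewrite ps ?j0.
  by apply/eqP; rewrite -subr_eq0 step // hh' ?leqnn // subrr mulr0 oppr0.
split=> // K1d; rewrite !newton_step -?eqs // -/h -/h'.
rewrite (eq_bigr (fun i : 'I_K.+1 => power_sum rs' i.+1 * h'`_(size rs - (K.+1 - i)))).
  by ring.
by move=> i _; rewrite psK ?hh' ?ltn_ord // subn_gt0 ltn_ord leq_subr.
Qed.
End NewtonCompare.

(** * Sign changes between two root vectors and weighted power sums *)

Section Interlacing.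
Variable R : rcfType.

Lemma prod_sign (I : Type) (s : seq I) (b : pred I) :
  \prod_(i <- s) (-1) ^+ b i = (-1) ^+ count b s :> R.
Proof.
by elim: s => [|i s IHs]; rewrite (big_nil, big_cons) //= IHs exprD.
Qed.


(** Used to read off the sign of the product of the [t - c j] for [t] between [y i] and [z i]. *)
Lemma odd_count_changes (eps : nat -> bool) i m : (i <= m)%N ->
  odd (count (fun j => (i <= j)%N && (eps j != eps j.+1)) (iota 0 m)) = eps i (+) eps m.
Proof.
elim: m => [|m IHm]; first by rewrite leqn0 => /eqP ->; rewrite addbb.
rewrite -addn1 iotaD count_cat oddD /= add0n addn0 leq_eqVlt => /orP[/eqP ->|].
  rewrite addn1 ltnn addbb (eq_in_count (a2 := pred0)) ?count_pred0 // => j.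
  by rewrite mem_iota /= add0n => jm; rewrite ltnNge ltnW.
rewrite addn1 ltnS => im; rewrite IHm // im /=.
by case: (eps i); case: (eps m); case: (eps m.+1).
Qed.

Lemma poly_primitive (p : {poly R}) : exists q : {poly R},
  [/\ q^`() = p, (size q <= (size p).+1)%N & forall k, q`_k.+1 = p`_k / k.+1%:R].
Proof.
pose q := \poly_(i < (size p).+1) (if i is j.+1 then p`_j / j.+1%:R else 0).
have qk k : q`_k.+1 = p`_k / k.+1%:R.
  rewrite coef_poly ltnS; case: ltnP => // kp.
  by rewrite nth_default ?mul0r.
exists q; split => //; last exact: size_poly.
by apply/polyP => i; rewrite coef_deriv qk -[LHS]mulr_natr divfK ?pnatr_eq0.
Qed.

Variables (l : nat) (y z : nat -> R).
Hypothesis ymono : forall i j, (i <= j < l)%N -> y i <= y j.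
Hypothesis zmono : forall i j, (i <= j < l)%N -> z i <= z j.

Let eps i := y i <= z i.
Let changes := count (fun j => eps j != eps j.+1) (iota 0 l.-1).

(* [q'] has a root between [i] and [i.+1] whenever the sign of [z - y] changes
   there, so that it keeps the sign of [z i - y i] between [y i] and [z i]. *)
Lemma separating_poly : exists q : {poly R},
  [/\ (size q <= changes.+2)%N, 0 < (-1) ^+ (~~ eps l.-1) * q`_changes.+1 &
   forall i, (i < l)%N -> y i != z i -> 0 < q.[z i] - q.[y i]].
Proof.
pose J := [seq j <- iota 0 l.-1 | eps j != eps j.+1].
(* At a sign change [j], monotonicity puts [c j] weakly above both values at every index up to [j]
   and weakly below both at every later one. *)
pose c j := Num.max (y j) (z j).
pose D := \prod_(j <- J) ('X - (c j)%:P).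
have sJ : size J = changes by rewrite size_filter.
have sD : size D = changes.+1.
  by rewrite /D -(big_map c xpredT (fun r => 'X - r%:P)) size_prod_XsubC size_map sJ.
have lcD : D`_changes = 1.
  have /monicP := monic_prod_XsubC J xpredT c.
  by rewrite /lead_coef sD.
(* Beyond all the [c j] the monic [D] is positive, so [s] gives [q'] the sign of [z - y] at the last
   index. *)
pose s : R := (-1) ^+ (~~ eps l.-1).
have [q [dq sq cq]] := poly_primitive (s *: D).
exists q; split.
- rewrite (leq_trans sq) // ltnS (leq_trans (size_scale_leq _ _)) //.
  by rewrite sD.
- by rewrite cq coefZ lcD mulr1 mulrA -/s -expr2 sqrr_sign mul1r invr_gt0 ltr0n.
move=> i il yz.
have iJ : (i <= l.-1)%N by rewrite -ltnS (leq_trans il) // leqSpred.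
have sgD t : Num.min (y i) (z i) < t < Num.max (y i) (z i) ->
    0 < (-1) ^+ (~~ eps i) * (s * D.[t]).
  move=> /andP[t1 t2].
  have : 0 < \prod_(j <- J) ((-1) ^+ (i <= j)%N * (t - c j)).
    rewrite big_seq; apply: prodr_gt0 => j; rewrite mem_filter mem_iota add0n.
    move=> /and3P[epsj _ jl]; have j1l : (j.+1 < l)%N by rewrite -ltn_predRL.
    have [ij|ji] := leqP i j; rewrite ?mul1r ?mulN1r ?expr0 ?expr1 ?mul1r ?mulN1r.
      rewrite oppr_gt0 subr_lt0 (lt_le_trans t2) // /c ge_max !le_max.
      by rewrite ymono ?zmono ?orbT //= ij ltnW.
    rewrite subr_gt0 (le_lt_trans _ t1) // /c le_min !ge_max.
    have yj : y j.+1 <= y i by rewrite ymono // ji.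
    have zj : z j.+1 <= z i by rewrite zmono // ji.
    have yj' : y j <= y j.+1 by rewrite ymono // leqnSn.
    have zj' : z j <= z j.+1 by rewrite zmono // leqnSn.
    move: epsj; rewrite /eps; case: leP => h1; case: leP => h2 // _; lra.
  rewrite big_split /= prod_sign count_filter -signr_odd odd_count_changes //.
  rewrite (_ : \prod_(j <- J) (t - c j) = D.[t]); last first.
    by rewrite /D horner_prod; apply: eq_bigr => j _; rewrite !hornerE.
  rewrite /s mulrA -signr_addb; congr (0 < (-1) ^+ nat_of_bool _ * _).
  by case: (eps i); case: (eps l.-1).
case/orP: (lt_total yz) => lyz.
  have [t tI ->] := poly_mvt q lyz; rewrite mulr_gt0 ?subr_gt0 //.
  have : 0 < (-1) ^+ (~~ eps i) * (s * D.[t]).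
    by apply: sgD; rewrite min_l ?max_r ?ltW // -in_itv.
  by rewrite dq hornerZ /eps ltW // mul1r.
have [t tI E] := poly_mvt q lyz; rewrite -oppr_lt0 opprB E pmulr_llt0 ?subr_gt0 //.
have : 0 < (-1) ^+ (~~ eps i) * (s * D.[t]).
  by apply: sgD; rewrite min_r ?max_l ?ltW // -in_itv.
by rewrite dq hornerZ /eps leNgt lyz /= expr1 mulN1r oppr_gt0.
Qed.

Variable w : nat -> nat.
Hypothesis w_gt0 : forall i, (i < l)%N -> (0 < w i)%N.

Definition weighted_sum (x : nat -> R) k := \sum_(i < l) (w i)%:R * x i ^+ k.

Lemma weighted_sum_poly (q : {poly R}) m : (size q <= m)%N ->
  \sum_(i < l) (w i)%:R * (q.[z i] - q.[y i]) =
  \sum_(k < m) q`_k * (weighted_sum z k - weighted_sum y k).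
Proof.
move=> qm; under [RHS]eq_bigr => k _ do rewrite /weighted_sum -sumrB mulr_sumr.
rewrite exchange_big; apply: eq_bigr => i _.
rewrite !(horner_coef_wide _ qm) -sumrB mulr_sumr; apply: eq_bigr => k _; ring.
Qed.

Lemma weighted_sum_gt0 (q : {poly R}) i0 : (i0 < l)%N -> y i0 != z i0 ->
  (forall i, (i < l)%N -> y i != z i -> 0 < q.[z i] - q.[y i]) ->
  0 < \sum_(i < l) (w i)%:R * (q.[z i] - q.[y i]).
Proof.
move=> i0l yz hq; rewrite (bigD1 (Ordinal i0l)) //= ltr_wpDr //.
  apply: sumr_ge0 => i _; have [->|/hq] := eqVneq (y i) (z i); first by rewrite subrr mulr0.
  by rewrite ltn_ord => /(_ isT)/ltW; apply: mulr_ge0.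
by rewrite mulr_gt0 ?hq // ltr0n w_gt0.
Qed.

Lemma changes_le : (changes <= l.-1)%N.
Proof. by rewrite (leq_trans (count_size _ _)) // size_iota. Qed.

(** The separating polynomial has degree at most [l], so its weighted sum is a combination of power
    sums that agree (the 0-th is the total weight), although it should be positive. *)
Lemma weighted_sum_inj : (forall k, (0 < k <= l)%N -> weighted_sum y k = weighted_sum z k) ->
  forall i, (i < l)%N -> y i = z i.
Proof.
move=> yz i il; apply/eqP; apply: contraT => nyz.
have [q [sq _ hq]] := separating_poly.
have := weighted_sum_gt0 il nyz hq; rewrite (weighted_sum_poly sq) big1 ?ltxx // => -[k kc] _.
rewrite /= (_ : weighted_sum y k = weighted_sum z k) ?subrr ?mulr0 //.
case: k kc => [|k] kc; first by apply: eq_bigr => j _; rewrite !expr0.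
apply: yz => /=; have l0 : (0 < l)%N by exact: leq_ltn_trans il.
have cl : (changes < l)%N by rewrite -[X in (_ < X)%N](prednK l0) ltnS changes_le.
exact: leq_trans (kc : (k < changes.+1)%N) cl.
Qed.

(* If [y] lies on a wall, [y i0 = y i0.+1], then the signs of [z - y] must
   alternate with exactly one choice of signs: the last power sum moves in
   one direction only. *)
Lemma weighted_sum_wall i0 : (i0.+1 < l)%N -> y i0 = y i0.+1 ->
  (forall k, (0 < k < l)%N -> weighted_sum y k = weighted_sum z k) ->
  (exists2 i, (i < l)%N & y i != z i) ->
  0 < (-1) ^+ (l - i0) * (weighted_sum z l - weighted_sum y l).
Proof.
move=> i0l yi0 yz [i il nyz].
have l0 : (0 < l)%N by exact: leq_ltn_trans il.
have [q [sq lq hq]] := separating_poly.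
have := weighted_sum_gt0 il nyz hq; rewrite (weighted_sum_poly sq).
have low k : (k < l)%N -> q`_k * (weighted_sum z k - weighted_sum y k) = 0.
  case: k => [|k] kl; last by rewrite yz ?kl // subrr mulr0.
  by rewrite (_ : weighted_sum z 0 = weighted_sum y 0) ?subrr ?mulr0.
(* With fewer than [l.-1] changes [q] has degree below [l] and only sees power sums that agree.
   Hence the sign changes at every step. *)
have [cl|cl] := ltnP changes l.-1.
  rewrite big1 ?ltxx // => k _; apply: low.
  by rewrite (leq_trans (ltn_ord k)) // -(prednK l0) ltnS.
have cE : changes = l.-1 by apply/eqP; rewrite eqn_leq changes_le.
have alt j : (j < l.-1)%N -> eps j != eps j.+1.
  have : all (fun j => eps j != eps j.+1) (iota 0 l.-1).
    by rewrite all_count -/changes cE size_iota.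
  by move=> /allP h jl; apply: h; rewrite mem_iota.
move: lq; rewrite cE prednK // => lq.
rewrite big_ord_recr big1 /=; last by move=> k _; apply: low.
rewrite add0r.
(* If [eps i0] held, then y_(i0+1) = y_i0 <= z_i0 <= z_(i0+1) would give the same sign at [i0.+1].
   Alternation now fixes every sign from [i0] on, and with it that of the leading coefficient of
   [q]. *)
have e0 : eps i0 = false.
  apply/negbTE/negP => e0; have := alt i0; rewrite -ltnS prednK // => /(_ i0l).
  have z1 : z i0 <= z i0.+1 by rewrite zmono // leqnSn.
  by rewrite e0 /eps -yi0 (le_trans e0).
have el m : (i0 <= m <= l.-1)%N -> eps m = odd (m - i0).
  elim: m => [|m IHm]; first by rewrite leqn0 => /andP[/eqP i00 _]; rewrite -i00 subnn e0.
  rewrite leq_eqVlt => /andP[/orP[/eqP <- _|im ml]]; first by rewrite subnn e0.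
  rewrite ltnS in im; have := alt m ml; rewrite IHm ?im ?(ltnW ml) // subSn //=.
  by case: (odd _); case: (eps _).
have -> : (-1) ^+ (l - i0) = (-1) ^+ (~~ eps l.-1) :> R.
  rewrite -signr_odd el; last by rewrite leqnn andbT -ltnS prednK // ltnW.
  by rewrite -{1}(prednK l0) subSn // -ltnS prednK // ltnW.
case: (eps l.-1) lq => /=; rewrite ?expr0 ?expr1 ?mul1r ?mulN1r.
  by move=> q0; rewrite pmulr_rgt0.
by rewrite oppr_gt0 => q0; rewrite nmulr_rgt0 // oppr_gt0.
Qed.
End Interlacing.

(** * Strata of hyperbolic polynomials *)

Section StratumParametrization.
Variables (R : realType) (d : nat) (u : seq nat).
Hypothesis u_gt0 : all (fun k => 0 < k)%N u.
Hypothesis u_sum : sumn u = d.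
Implicit Types Y Z : nat -> R.

(** Root vectors are functions on [nat], of which only the values below [size u] matter. *)
Definition stratum_roots Y :=
  flatten [seq nseq (nth 0%N u i) (Y i) | i <- iota 0 (size u)].

Definition stratum_poly Y := \prod_(r <- stratum_roots Y) ('X - r%:P).

Definition weak_chamber Y := forall i j, (i <= j < size u)%N -> Y i <= Y j.

Definition open_chamber Y := forall i j, (i < j < size u)%N -> Y i < Y j.

Lemma u_nth_gt0 i : (i < size u)%N -> (0 < nth 0 u i)%N.
Proof. by move=> il; apply: (allP u_gt0); exact: mem_nth. Qed.

Lemma big_stratum_roots (V : Type) (idx : V) (op : Monoid.law idx) (F : R -> V) Y :
  \big[op/idx]_(r <- stratum_roots Y) F r =
  \big[op/idx]_(i < size u) iterop (nth 0%N u i) op (F (Y i)) idx.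
Proof.
rewrite big_flatten big_map /= -(big_mkord xpredT (fun i => iterop (nth 0%N u i) op (F (Y i)) idx)).
rewrite /index_iota subn0; apply: eq_bigr => i _.
by rewrite big_nseq Monoid.iteropE.
Qed.

Lemma size_stratum_roots Y : size (stratum_roots Y) = d.
Proof.
rewrite size_flatten /shape -map_comp -u_sum; congr sumn.
rewrite -[RHS](mkseq_nth 0%N) /mkseq; apply: eq_map => i /=; exact: size_nseq.
Qed.

Lemma size_u_le : (size u <= d)%N.
Proof.
rewrite -u_sum; elim: (u) u_gt0 => //= k t IHt /andP[k0 /IHt h].
by rewrite -add1n leq_add.
Qed.

Lemma stratum_polyE Y :
  stratum_poly Y = \prod_(i < size u) ('X - (Y i)%:P) ^+ nth 0%N u i.
Proof. by rewrite /stratum_poly big_stratum_roots. Qed.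

Lemma stratum_poly_ext Y Z : (forall i, (i < size u)%N -> Y i = Z i) ->
  stratum_poly Y = stratum_poly Z.
Proof. by move=> YZ; rewrite !stratum_polyE; apply: eq_bigr => i _; rewrite YZ. Qed.

Lemma size_stratum_poly Y : size (stratum_poly Y) = d.+1.
Proof. by rewrite size_prod_XsubC size_stratum_roots. Qed.

Lemma lead_stratum_poly Y : (stratum_poly Y)`_d = 1.
Proof.
have /monicP := monic_prod_XsubC (stratum_roots Y) xpredT id.
by rewrite /lead_coef -/(stratum_poly Y) size_stratum_poly.
Qed.

Lemma power_sum_stratum Y k :
  power_sum (stratum_roots Y) k = weighted_sum (size u) (nth 0%N u) Y k.
Proof.
rewrite /power_sum big_stratum_roots; apply: eq_bigr => i _.
by rewrite Monoid.iteropE iter_addr_0 mulr_natl.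
Qed.

Lemma stratum_poly_inj Y Z : weak_chamber Y -> weak_chamber Z ->
  (forall j, (j < size u)%N -> (stratum_poly Y)`_(d - j.+1) = (stratum_poly Z)`_(d - j.+1)) ->
  forall i, (i < size u)%N -> Y i = Z i.
Proof.
move=> cY cZ YZ; apply: (weighted_sum_inj cY cZ u_nth_gt0) => k kl.
rewrite -!power_sum_stratum.
have [|||+ _] := @power_sum_coef _ (stratum_roots Y) (stratum_roots Z) (size u).
- by rewrite !size_stratum_roots.
- by rewrite size_stratum_roots size_u_le.
- by rewrite size_stratum_roots => -[//|j] /andP[_ jl]; exact: YZ.
by apply.
Qed.

(** [weighted_sum_wall] transported to coefficients: when the earlier coefficients agree, the last
    power sum changes by a negative multiple of the change in the coefficient. *)
Lemma stratum_poly_wall Y Z i0 : weak_chamber Y -> weak_chamber Z ->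
  (i0.+1 < size u)%N -> Y i0 = Y i0.+1 ->
  (forall j, (j.+1 < size u)%N -> (stratum_poly Y)`_(d - j.+1) = (stratum_poly Z)`_(d - j.+1)) ->
  (exists2 i, (i < size u)%N & Y i != Z i) ->
  (-1) ^+ (size u - i0) *
    ((stratum_poly Z)`_(d - size u) - (stratum_poly Y)`_(d - size u)) < 0.
Proof.
move=> cY cZ i0l Yi0 YZ nYZ; have l0 : (0 < size u)%N by exact: leq_ltn_trans i0l.
have [|||ps step] := @power_sum_coef _ (stratum_roots Y) (stratum_roots Z) (size u).-1.
- by rewrite !size_stratum_roots.
- by rewrite size_stratum_roots (leq_trans (leq_pred _)) // size_u_le.
- by rewrite size_stratum_roots => -[//|j] /andP[_ jl]; apply: YZ; rewrite -ltn_predRL.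
have := weighted_sum_wall cY cZ u_nth_gt0 i0l Yi0.
rewrite -!power_sum_stratum => /(_ _ nYZ) h.
move: step; rewrite prednK // size_stratum_roots => /(_ size_u_le).
rewrite -/(stratum_poly Y) -/(stratum_poly Z) => step.
have : 0 < (-1) ^+ (size u - i0) * (power_sum (stratum_roots Z) (size u) -
    power_sum (stratum_roots Y) (size u)).
  apply: h => k /andP[k0 kl]; rewrite -!power_sum_stratum ps // k0 /=.
  by rewrite -ltnS prednK.
rewrite -[X in _ * X]opprB step opprK mulrCA => h1.
have : 0 < (-1) ^+ (size u - i0) *
   ((stratum_poly Y)`_(d - size u) - (stratum_poly Z)`_(d - size u)).
  by rewrite pmulr_rgt0 ?ltr0n // in h1.
by rewrite -opprB mulrN oppr_gt0.
Qed.

Lemma hyperbolic_prod_mup (h : {poly R}) rs : hyperbolic h -> uniq rs ->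
  (forall r, root h r <-> r \in rs) ->
  h = \prod_(r <- rs) ('X - r%:P) ^+ mup r h.
Proof.
move=> [rs0 hE] urs hrs.
have mupE r : mup r h = count_mem r rs0 by rewrite hE mu_prod_XsubC.
rewrite {1}hE -(perm_big _ (perm_count_undup rs0)) /= big_flatten big_map.
have prs : perm_eq (undup rs0) rs.
  apply: uniq_perm => //; first exact: undup_uniq.
  move=> r; rewrite mem_undup -root_prod_XsubC -hE.
  by apply/idP/idP => /hrs.
rewrite (perm_big _ prs) /=; apply: eq_bigr => r _.
by rewrite big_nseq mupE -Monoid.iteropE.
Qed.

Lemma root_mult_comp_poly (h : {poly R}) rs : hyperbolic h -> sorted <%R rs ->
  (forall r, root h r <-> r \in rs) -> u = [seq mup r h | r <- rs] ->
  open_chamber (nth 0 rs) /\ h = stratum_poly (nth 0 rs).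
Proof.
move=> hh srs hrs uE.
have szE : size u = size rs by rewrite uE size_map.
split=> [i j /andP[ij jl]|].
  by rewrite (sorted_ltn_nth lt_trans) // ?inE -szE // (ltn_trans ij).
rewrite {1}(hyperbolic_prod_mup hh _ hrs); last by apply: sorted_uniq srs; [exact: lt_trans|exact: ltxx].
rewrite stratum_polyE szE (big_nth 0) big_mkord; apply: eq_bigr => i _.
by rewrite uE (nth_map 0) // -szE.
Qed.

(** Each root is repeated once for every part of its block, which turns strictly increasing roots
    into a weakly increasing vector indexed by the unmerged parts. *)
Lemma flatten_blocks (rs : seq R) (ss : seq (seq nat)) : size ss = size rs ->
  sorted <%R rs ->
  let Ys := flatten [seq nseq (size p.2) p.1 | p <- zip rs ss] in
  [/\ size Ys = size (flatten ss), pairwise <=%R Ys, {subset Ys <= rs} &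
   \prod_(p <- zip Ys (flatten ss)) ('X - p.1%:P) ^+ p.2 =
   \prod_(p <- zip rs ss) ('X - p.1%:P) ^+ sumn p.2].
Proof.
elim: rs ss => [|r rs IHrs] [|b ss] //= ; first by rewrite !big_nil.
move=> [sz] srs; have [h1 h2 h3 h4] := IHrs ss sz (path_sorted srs).
split.
- by rewrite !size_cat size_nseq h1.
- rewrite pairwise_cat h2 andbT; apply/andP; split; last first.
    by elim: (size b) => //= k ->; rewrite andbT; apply/allP => x /nseqP[->].
  apply/allrelP => x y /nseqP[-> _] /h3 yrs.
  by move: srs; rewrite (path_sortedE lt_trans) => /andP[/allP/(_ y yrs)/ltW].
- move=> x; rewrite mem_cat inE => /orP[/nseqP[-> _]|/h3 ->]; rewrite ?eqxx ?orbT //.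
rewrite zip_cat ?size_nseq // big_cat big_cons /= h4; congr (_ * _).
elim: b {h4} => [|k b IHb] /=; first by rewrite big_nil expr0.
by rewrite big_cons IHb exprD.
Qed.

Lemma comp_le_poly (x : {poly R}) v : hyperbolic x -> root_mult_comp x v -> comp_le v u ->
  exists2 Y, weak_chamber Y & x = stratum_poly Y.
Proof.
move=> hx [rs [srs [hrs vE]]] [ss [ssu [_ ssv]]].
have szE : size ss = size rs by rewrite -(size_map sumn) ssv vE size_map.
have := flatten_blocks szE srs; rewrite ssu.
set Ys := flatten _ => -[h1 /pairwiseP h2 _ h4].
exists (nth 0 Ys).
  move=> i j /andP[]; rewrite leq_eqVlt => /orP[/eqP -> //|ij] jl.
  by rewrite h2 // inE h1 // (ltn_trans ij).
rewrite {1}(hyperbolic_prod_mup hx _ hrs); last by apply: sorted_uniq srs; [exact: lt_trans|exact: ltxx].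
rewrite stratum_polyE.
have -> : \prod_(i < size u) ('X - (nth 0 Ys i)%:P) ^+ nth 0%N u i =
    \prod_(p <- zip Ys u) ('X - p.1%:P) ^+ p.2.
  rewrite (big_nth (0, 0%N)) size_zip h1 minnn big_mkord; apply: eq_bigr => i _.
  by rewrite nth_zip.
rewrite h4 (big_nth 0) (big_nth (0, [::])) size_zip szE minnn; apply: eq_big_nat => i /= il.
rewrite nth_zip //=; congr (_ ^+ _).
rewrite -(nth_map 0 0%N (fun r => mup r x)) // -vE -ssv (nth_map [::]) // szE //.
Qed.

Lemma open_chamber_weak Y : open_chamber Y -> weak_chamber Y.
Proof.
move=> oY i j; rewrite leq_eqVlt => /andP[/orP[/eqP -> //|ij] jl].
by rewrite ltW // oY // ij.
Qed.

Lemma open_chamberPn Y : weak_chamber Y -> ~ open_chamber Y ->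
  exists2 i, (i.+1 < size u)%N & Y i = Y i.+1.
Proof.
move=> cY nY; apply: contrapT => nE; apply: nY => i j /andP[ij jl].
have step k : (k.+1 < size u)%N -> Y k < Y k.+1.
  move=> kl; rewrite lt_neqAle cY ?leqnSn // andbT; apply/eqP => Yk.
  by apply: nE; exists k.
have il := ltn_trans ij jl.
by apply: lt_le_trans (step i _) (cY _ _ _); rewrite ?ij ?(leq_ltn_trans ij).
Qed.

Lemma open_chamber_comp Y : open_chamber Y ->
  [/\ hyperbolic (stratum_poly Y), root_mult_comp (stratum_poly Y) u & comp_le u u].
Proof.
move=> oY; split; first by exists (stratum_roots Y).
  exists (mkseq Y (size u)); split; last split.
  - apply/(sortedP 0) => i; rewrite size_mkseq => il.
    by rewrite !nth_mkseq ?oY ?ltnSn // ltnW.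
  - move=> r; rewrite root_prod_XsubC; split.
      move=> /flattenP[t /mapP[i +] -> /nseqP[-> _]]; rewrite mem_iota add0n => il.
      by apply: map_f; rewrite mem_iota.
    move=> /mapP[i]; rewrite mem_iota add0n => il ->; apply/flattenP.
    exists (nseq (nth 0%N u i) (Y i)); first by apply: map_f; rewrite mem_iota.
    by apply/nseqP; split => //; apply: u_nth_gt0.
  rewrite -[LHS](mkseq_nth 0%N) -map_comp; apply/eq_in_map => i.
  rewrite mem_iota add0n => il /=; rewrite mu_prod_XsubC -sum1_count big_mkcond.
  rewrite big_stratum_roots (bigD1 (Ordinal il)) //= eqxx big1 ?addn0.
    by rewrite Monoid.iteropE iter_addn_0 mul1n.
  move=> j; rewrite -val_eqE neq_ltn => /orP[] /= h; rewrite Monoid.iteropE iter_addn_0.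
    by rewrite lt_eqF ?oY ?h.
  by rewrite gt_eqF ?oY ?h //=.
exists [seq [:: k] | k <- u]; split; last split.
- by rewrite -[RHS]flatten_seq1 //.
- by apply/allP => _ /mapP[k _ ->].
by rewrite -map_comp map_id_in // => k _ /=; rewrite addn0.
Qed.

End StratumParametrization.

(** * Continuity of polynomial families, coefficient by coefficient *)

Section PolynomialCoefficients.
Variable R : realType.

Lemma continuous_sum (T : topologicalType) m (f : 'I_m -> T -> R) :
  (forall i, continuous (f i)) -> continuous (fun x => \sum_(i < m) f i x).
Proof.
elim: m f => [|m IHm] f cf.
  rewrite (_ : (fun x => _) = cst 0); first exact: cst_continuous.
  by apply/funext => x; rewrite big_ord0.
rewrite (_ : (fun x => _) = fun x => \sum_(i < m) f (widen_ord (leqnSn m) i) x + f ord_max x).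
  by move=> x; apply: cvgD; [exact: IHm|exact: cf].
by apply/funext => x; rewrite big_ord_recr.
Qed.

Definition coef_continuous (T : topologicalType) (p : T -> {poly R}) :=
  forall k, continuous (fun x => (p x)`_k).

Lemma coef_continuousM (T : topologicalType) (p q : T -> {poly R}) :
  coef_continuous p -> coef_continuous q -> coef_continuous (fun x => p x * q x).
Proof.
move=> cp cq k; rewrite (_ : (fun x => _) = fun x => \sum_(i < k.+1) (p x)`_i * (q x)`_(k - i)).
  by apply: continuous_sum => i x; apply: cvgM; [exact: cp|exact: cq].
by apply/funext => x; rewrite coefM.
Qed.

Lemma coef_continuous1 (T : topologicalType) : coef_continuous (fun _ : T => 1 : {poly R}).
Proof. by move=> k; exact: cst_continuous. Qed.

Lemma coef_continuousX (T : topologicalType) (p : T -> {poly R}) n :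
  coef_continuous p -> coef_continuous (fun x => p x ^+ n).
Proof.
move=> cp; elim: n => [|n IHn]; first exact: coef_continuous1.
by under [fun x => _]funext => x do rewrite exprS; exact: coef_continuousM.
Qed.

Lemma coef_continuous_prod (T : topologicalType) m (p : 'I_m -> T -> {poly R}) :
  (forall i, coef_continuous (p i)) -> coef_continuous (fun x => \prod_(i < m) p i x).
Proof.
elim: m p => [|m IHm] p cp.
  rewrite (_ : (fun x => _) = fun=> 1); first exact: coef_continuous1.
  by apply/funext => x; rewrite big_ord0.
rewrite (_ : (fun x => _) = fun x => (\prod_(i < m) p (widen_ord (leqnSn m) i) x) * p ord_max x).
  by apply: coef_continuousM; [exact: IHm|exact: cp].
by apply/funext => x; rewrite big_ord_recr.
Qed.

Lemma coef_continuous_XsubC (T : topologicalType) (f : T -> R) :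
  continuous f -> coef_continuous (fun x => 'X - (f x)%:P).
Proof.
move=> cf k; rewrite (_ : (fun x => _) = fun x => (k == 1)%:R - (if k == 0 then f x else 0)).
  move=> x; apply: cvgB; first exact: cvg_cst.
  by case: (k == 0); [exact: cf|exact: cvg_cst].
by apply/funext => x; rewrite coefB coefX coefC.
Qed.
End PolynomialCoefficients.

(** * Coordinates of a polynomial with prescribed first coefficients *)

Section HpolyCoefficients.
Variables (R : realType) (d : nat) (f : {poly R}) (s : nat).
Hypothesis s_le_d : (s <= d)%N.

(** Entry [k] of [x] is the coefficient h_(s+k+1), so h_j is found at [j - s.+1]; for s < j <= d the
    [insub] succeeds. *)
Lemma hpoly_coef (x : 'rV[R]_(d - s)) j : (0 < j <= d)%N ->
  (hpoly d s f x)`_(d - j) =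
  if (j <= s)%N then f`_(d - j) else
  if insub (j - s.+1)%N is Some k then x ord0 k else 0.
Proof.
move=> /andP[j0 jd]; rewrite /hpoly !coefD coefXn !coef_sum.
have -> : (d - j == d)%N = false by apply/negbTE; lia.
rewrite add0r.
under eq_bigr => i _ do rewrite coefZ coefXn.
under [X in _ + X]eq_bigr => i _ do rewrite coefZ coefXn.
case: leqP => js.
  rewrite [X in _ + X]big1 ?addr0 => [|k _]; last first.
    by rewrite (_ : (_ == _)%N = false) ?mulr0 //; have := ltn_ord k; lia.
  have j1s : (j.-1 < s)%N by rewrite prednK.
  rewrite (bigD1 (Ordinal j1s)) //= prednK // eqxx mulr1 big1 ?addr0 // => i.
  rewrite -val_eqE /= => ij; have il := ltn_ord i.
  by rewrite (_ : (_ == _)%N = false) ?mulr0 //; lia.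
rewrite big1 ?add0r => [|i _]; last first.
  by rewrite (_ : (_ == _)%N = false) ?mulr0 //; have := ltn_ord i; lia.
have jds : (j - s.+1 < d - s)%N by lia.
rewrite insubT /= (bigD1 (Ordinal jds)) //= big1 ?addr0 => [|i].
  by rewrite (_ : (_ == _)%N = true) ?mulr1 //; lia.
rewrite -val_eqE /= => ij; have il := ltn_ord i.
by rewrite (_ : (_ == _)%N = false) ?mulr0 //; lia.
Qed.

Lemma hpoly_lead (x : 'rV[R]_(d - s)) : (hpoly d s f x)`_d = 1.
Proof.
rewrite /hpoly !coefD coefXn eqxx !coef_sum !big1 ?addr0 // => i _; rewrite coefZ coefXn;
  by rewrite (_ : (_ == _)%N = false) ?mulr0 //; have := ltn_ord i; lia.
Qed.

Lemma size_hpoly (x : 'rV[R]_(d - s)) : (size (hpoly d s f x) <= d.+1)%N.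
Proof.
apply/leq_sizeP => j dj; rewrite /hpoly !coefD coefXn !coef_sum gtn_eqF //.
by rewrite !big1 ?addr0 // => i _; rewrite coefZ coefXn gtn_eqF ?mulr0 //; lia.
Qed.

Lemma hpoly_eq (x : 'rV[R]_(d - s)) (h : {poly R}) : (size h <= d.+1)%N -> h`_d = 1 ->
  (forall j, (0 < j <= s)%N -> h`_(d - j) = f`_(d - j)) ->
  (forall k : 'I_(d - s), x ord0 k = h`_(d - (s + k.+1))) ->
  hpoly d s f x = h.
Proof.
move=> sh hd hf hx; apply/polyP => i.
have [id|di] := ltnP d i.
  by rewrite !nth_default ?(leq_trans (size_hpoly x)) ?(leq_trans sh).
have [->|id] := eqVneq i d; first by rewrite hpoly_lead hd.
have -> : i = (d - (d - i))%N by lia.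
rewrite hpoly_coef; last by lia.
case: leqP => h1; first by rewrite hf //; lia.
have h2 : (d - i - s.+1 < d - s)%N by lia.
rewrite insubT /= hx /=; congr (h`__); lia.
Qed.

Lemma hpoly_inj (x x' : 'rV[R]_(d - s)) : hpoly d s f x = hpoly d s f x' -> x = x'.
Proof.
move=> xx'; apply/rowP => k; have := congr1 (fun h : {poly R} => h`_(d - (s + k.+1))) xx'.
have kd := ltn_ord k.
have hk : (0 < s + k.+1 <= d)%N by lia.
have ks : (s + k.+1 <= s)%N = false by lia.
have kE : (s + k.+1 - s.+1)%N = k by lia.
by rewrite /= !hpoly_coef // ks kE valK.
Qed.
End HpolyCoefficients.

(** * Row vectors as functions on the natural numbers *)

Section RowFunctions.
Variable R : realType.

Lemma within_continuous_comp (U V W : normedModType R) (A : set U) (B : set V)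
    (h : U -> V) (g : V -> W) :
  {within A, continuous h} -> (forall x, A x -> B (h x)) ->
  {within B, continuous g} -> {within A, continuous (g \o h)}.
Proof.
move=> /within_continuousP ch AB /within_continuousP cg.
apply/within_continuousP => x Ax e e0.
have [d1 d10 h1] := cg _ (AB _ Ax) e e0; have [d2 d20 h2] := ch _ Ax _ d10.
by exists d2 => // y Ay /(h2 _ Ay) /h1; apply; exact: AB.
Qed.

Definition row_fun m (y : 'rV[R]_m) (i : nat) : R :=
  if insub i is Some j then y ord0 j else 0.

Lemma row_fun_ord m (y : 'rV[R]_m) (i : 'I_m) : row_fun y i = y ord0 i.
Proof. by rewrite /row_fun valK. Qed.

Lemma row_fun_lt m (y : 'rV[R]_m) i (im : (i < m)%N) : row_fun y i = y ord0 (Ordinal im).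
Proof. by rewrite -row_fun_ord. Qed.

Lemma row_funE m (Y : nat -> R) i : (i < m)%N -> row_fun (\row_(j < m) Y j) i = Y i.
Proof. by move=> im; rewrite row_fun_lt mxE. Qed.

Lemma row_fun_continuous m i : continuous (fun y : 'rV[R]_m => row_fun y i).
Proof.
rewrite /row_fun; case E : (@insub nat (fun k => k < m)%N 'I_m i) => [j|].
  exact: coord_continuous.
exact: cst_continuous.
Qed.

Lemma increasing_open (T : topologicalType) m (g : 'I_m -> T -> R) :
  (forall i, continuous (g i)) ->
  open [set z | forall i j : 'I_m, (i < j)%N -> g i z < g j z].
Proof.
move=> cg; rewrite openE => y Cy.
have : \forall z \near y, forall p : 'I_m * 'I_m, (p.1 < p.2)%N -> g p.1 z < g p.2 z.
  apply: filter_forall => -[i j] /=; have [ij|ij] := ltnP i j; last by near=> z.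
  have g0 : 0 < g j y - g i y by rewrite subr_gt0 Cy.
  have cB : g j z - g i z @[z --> y] --> g j y - g i y by apply: cvgB; exact: cg.
  near=> z => _; rewrite -subr_gt0; near: z; exact: (cvgr_gt _ cB).
by apply: filterS => z hz i j; exact: (hz (i, j)).
Unshelve. all: by end_near. Qed.

End RowFunctions.

(** * The stratum and its projection to the coefficients of index s+1 to l *)

Section Stratum.
Variables (R : realType) (d : nat) (f : {poly R}) (s : nat) (u : seq nat).
Hypothesis s_le_d : (s <= d)%N.
Hypothesis u_gt0 : all (fun k => 0 < k)%N u.
Hypothesis u_sum : sumn u = d.

Notation l := (size u).
Notation n := (size u - s)%N.
Notation poly_of y := (stratum_poly u (row_fun y)).
Notation stratum := (Hsu d s f u).

Let l_le_d : (l <= d)%N := size_u_le u_gt0 u_sum.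

Definition top_coefs (y : 'rV[R]_l) : 'rV[R]_l := \row_j (poly_of y)`_(d - j.+1).

Definition chamber : set 'rV[R]_l := [set y | open_chamber u (row_fun y)].

Lemma poly_of_continuous : coef_continuous (fun y : 'rV[R]_l => poly_of y).
Proof.
rewrite (_ : (fun y => _) = fun y : 'rV[R]_l =>
    \prod_(i < l) ('X - (row_fun y i)%:P) ^+ nth 0%N u i).
  apply: coef_continuous_prod => i; apply: coef_continuousX.
  by apply: coef_continuous_XsubC; exact: row_fun_continuous.
by apply/funext => y; rewrite stratum_polyE.
Qed.

Lemma top_coefs_continuous : continuous top_coefs.
Proof.
apply: continuous_rowP => i; rewrite (_ : (fun y => _) = fun y => (poly_of y)`_(d - i.+1)).
  exact: poly_of_continuous.
by apply/funext => y; rewrite mxE.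
Qed.

Lemma chamber_open : open chamber.
Proof.
rewrite (_ : chamber = [set y | forall i j : 'I_l, (i < j)%N -> row_fun y i < row_fun y j]).
  by apply: (@increasing_open _ _ l (fun i y => row_fun y i)) => i; exact: row_fun_continuous.
apply/seteqP; split => y Cy => [i j ij|i j /andP[ij jl]]; first by rewrite Cy // ij /=.
exact: (Cy (Ordinal (ltn_trans ij jl)) (Ordinal jl)).
Qed.

Lemma top_coefs_inj y z : weak_chamber u (row_fun y) -> weak_chamber u (row_fun z) ->
  top_coefs y = top_coefs z -> y = z.
Proof.
move=> cy cz /rowP yz; apply/rowP => i; rewrite -!row_fun_ord.
apply: (stratum_poly_inj u_gt0 u_sum cy cz) => // j jl.
by have := yz (Ordinal jl); rewrite !mxE.
Qed.

Lemma chamber_inj : {in chamber &, injective top_coefs}.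
Proof.
by move=> y z; rewrite !inE => /open_chamber_weak cy /open_chamber_weak cz; exact: top_coefs_inj.
Qed.

Lemma image_chamber_open (A : set 'rV[R]_l) : open A -> A `<=` chamber -> open (top_coefs @` A).
Proof.
move=> oA AC; apply: invariance_of_domain => //.
  by apply: continuous_subspaceT; exact: top_coefs_continuous.
by move=> y z; rewrite !inE => /AC yC /AC zC; apply: chamber_inj; rewrite inE.
Qed.

(** The inverse is continuous because [top_coefs] is an open map on the chamber. *)
Lemma chamber_inverse : exists g : 'rV[R]_l -> 'rV[R]_l,
  (forall y, chamber y -> g (top_coefs y) = y) /\
  {within top_coefs @` chamber, continuous g}.
Proof.
pose g w := xget 0 [set y | chamber y /\ top_coefs y = w].
have gE y : chamber y -> g (top_coefs y) = y.
  move=> Cy; have [h1 h2] : chamber (g (top_coefs y)) /\ top_coefs (g (top_coefs y)) = top_coefs y.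
    exact: (@xgetPex _ 0 [set z | chamber z /\ top_coefs z = top_coefs y] (ex_intro _ y (conj Cy erefl))).
  by apply: chamber_inj; rewrite ?inE.
exists g; split => //; apply/within_continuousP => _ [y Cy <-] e e0.
have oB : open (chamber `&` [set z | `|z - y| < e]).
  apply: openI; first exact: chamber_open.
  apply/open_normP => z /= ze; exists (e - `|z - y|); first by rewrite subr_gt0.
  by move=> z' zz'; have := ler_distD z z' y; lra.
have [||d' d'0 hd'] := (open_normP _).1 (image_chamber_open oB _) (top_coefs y).
- by move=> z [].
- by exists y => //; split => //=; rewrite subrr normr0.
exists d' => // _ [z Cz <-] /hd'[z' [Cz' z'y] E].
by rewrite !gE //; have <- : z' = z by apply: chamber_inj; rewrite ?inE.
Qed.

Definition proj (x : 'rV[R]_(d - s)) : 'rV[R]_n := \row_k row_fun x k.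

(** Puts the prescribed coefficients in front of [w], giving the first [l] coefficients of the
    polynomial; for [s >= l] only prescribed ones occur. *)
Definition complete (w : 'rV[R]_n) : 'rV[R]_l :=
  \row_j (if (j < s)%N then f`_(d - j.+1) else row_fun w (j - s)).

Lemma proj_continuous : continuous proj.
Proof.
apply: continuous_rowP => i; rewrite (_ : (fun y => _) = fun y => row_fun y i).
  exact: row_fun_continuous.
by apply/funext => y; rewrite mxE.
Qed.

Lemma complete_continuous : continuous complete.
Proof.
apply: continuous_rowP => i; case E : (i < s)%N.
  rewrite (_ : (fun y => _) = cst f`_(d - i.+1)); first exact: cst_continuous.
  by apply/funext => y; rewrite mxE E.
rewrite (_ : (fun y => _) = fun y => row_fun y (i - s)).
  exact: row_fun_continuous.
by apply/funext => y; rewrite mxE E.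
Qed.

Lemma complete_proj x Y : hpoly d s f x = stratum_poly u Y ->
  complete (proj x) = \row_j (stratum_poly u Y)`_(d - j.+1).
Proof.
move=> <-; apply/rowP => j; have jl := ltn_ord j.
rewrite !mxE hpoly_coef //; last by lia.
case: ltnP => // sj; rewrite row_funE; last by lia.
by rewrite subSS.
Qed.

Lemma stratumP x : stratum x ->
  exists y : 'rV[R]_l, [/\ weak_chamber u (row_fun y), hpoly d s f x = poly_of y &
    top_coefs y = complete (proj x)].
Proof.
move=> [hx [v [xv vu]]].
have [Y cY xY] := comp_le_poly hx xv vu.
have YE i : (i < l)%N -> row_fun (\row_(j < l) Y j) i = Y i by exact: row_funE.
have pE : poly_of (\row_(j < l) Y j) = stratum_poly u Y by exact: stratum_poly_ext.
exists (\row_j Y j); split.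
- move=> i j /andP[ij jl]; rewrite !YE ?(leq_ltn_trans ij) //; by apply: cY; rewrite ij.
- by rewrite pE.
- by rewrite (complete_proj xY) /top_coefs pE.
Qed.

(** The projection and the prescribed coefficients give the first [l] coefficients, which determine
    the root vector. *)
Lemma proj_inj x x' : stratum x -> stratum x' -> proj x = proj x' -> x = x'.
Proof.
move=> /stratumP[y [cy xy yE]] /stratumP[y' [cy' xy' yE']] xx'.
apply: (hpoly_inj (f := f) s_le_d); rewrite xy xy'; congr (stratum_poly u (row_fun _)).
by apply: top_coefs_inj => //; rewrite yE yE' xx'.
Qed.

Lemma chamber_stratum x y : chamber y -> hpoly d s f x = poly_of y ->
  stratum x /\ root_mult_comp (hpoly d s f x) u.
Proof.
move=> Cy xy; have [h1 h2 h3] := open_chamber_comp u_gt0 Cy.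
by rewrite /Hsu /Hs /= xy; split => //; split => //; exists u.
Qed.

Lemma strict_stratumP x : stratum x -> root_mult_comp (hpoly d s f x) u ->
  exists2 y, chamber y & hpoly d s f x = poly_of y.
Proof.
move=> [hx _] [rs [srs [hrs uE]]].
have [oY xY] := root_mult_comp_poly hx srs hrs uE.
have YE i : (i < l)%N -> row_fun (\row_(j < l) nth 0 rs j) i = nth 0 rs i by exact: row_funE.
exists (\row_j nth 0 rs j); last by rewrite xY; apply/esym/stratum_poly_ext.
by move=> i j /andP[ij jl]; rewrite !YE ?(ltn_trans ij) //; apply: oY; rewrite ij.
Qed.

(** Following a chart by [proj] gives a continuous injection of an open set of R^m into R^n. *)
Lemma stratum_dim_le m (A : set 'rV[R]_(d - s)) (V : set 'rV[R]_m) :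
  A `<=` stratum -> open V -> V !=set0 -> homeomorphic_sets A V -> (m <= n)%N.
Proof.
move=> AS oV V0 [phi [psi [_ [cpsi [_ [psiA [_ phipsi]]]]]]].
apply: (invariance_of_dimension (f := proj \o psi) oV V0).
  by move=> x; apply: (cvg_comp psi proj (cpsi x)); exact: proj_continuous.
move=> v w; rewrite !inE => Vv Vw /= /proj_inj vw.
by rewrite -(phipsi v) // -(phipsi w) // vw //; apply: AS; exact: psiA.
Qed.

(** * Dimension and relative interior, given a point with composition exactly u *)

Section Witness.
Variable x0 : 'rV[R]_(d - s).
Hypothesis Sx0 : stratum x0.
Hypothesis x0_comp : root_mult_comp (hpoly d s f x0) u.

Let base : exists2 y0, chamber y0 & hpoly d s f x0 = poly_of y0 := strict_stratumP Sx0 x0_comp.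

Definition strict_image : set 'rV[R]_n := complete @^-1` (top_coefs @` chamber).

Lemma strict_image_open : open strict_image.
Proof.
apply: open_comp; first by move=> w _; exact: complete_continuous.
by apply: image_chamber_open => //; exact: chamber_open.
Qed.

(* When [s > l] the first [l] coefficients already determine the polynomial,
   which must then be that of [x0]. *)
Lemma strict_image_coef w y : chamber y -> top_coefs y = complete w ->
  forall j, (0 < j <= s)%N -> (poly_of y)`_(d - j) = f`_(d - j).
Proof.
move=> Cy yw j /andP[j0 js]; have [jl|lj] := leqP j l.
  have j1l : (j.-1 < l)%N by rewrite prednK.
  by move/rowP: yw => /(_ (Ordinal j1l)); rewrite !mxE /= prednK // js.
have [y0 Cy0 x0E] := base.
have -> : y = y0.
  apply: chamber_inj; rewrite ?inE // yw.
  have -> : top_coefs y0 = complete (proj x0) by rewrite (complete_proj x0E).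
  congr complete; apply/rowP => -[k kn]; exfalso; lia.
by rewrite -x0E hpoly_coef ?js //; lia.
Qed.

(** The inverse of [proj] recovers the root vector from its first [l] coefficients by [g] and reads
    the remaining coefficients off its polynomial. *)
Lemma strict_homeomorphic : homeomorphic_sets (stratum `&` proj @^-1` strict_image) strict_image.
Proof.
have [g [gE cg]] := chamber_inverse.
pose psi w : 'rV[R]_(d - s) := \row_k (poly_of (g (complete w)))`_(d - (s + k.+1)).
have psiP w y : chamber y -> top_coefs y = complete w -> hpoly d s f (psi w) = poly_of y.
  move=> Cy yw; apply: (hpoly_eq s_le_d).
  - by rewrite (size_stratum_poly u_sum).
  - exact: (lead_stratum_poly u_sum).
  - exact: (strict_image_coef Cy yw).
  - by move=> k; rewrite mxE -yw gE.
have projpsi w : strict_image w -> proj (psi w) = w.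
  move=> [y Cy yw]; have := complete_proj (psiP w y Cy yw).
  rewrite -/(top_coefs y) yw => /rowP E; apply/rowP => k; have kn := ltn_ord k.
  have skl : (s + k < l)%N by lia.
  have := E (Ordinal skl); rewrite !mxE /= ltnNge leq_addr /= addKn !row_fun_ord => <-.
  by rewrite !mxE.
exists proj, psi; split; [|split; [|split; [|split; [|split]]]].
- by apply: continuous_subspaceT; exact: proj_continuous.
- have cgc : {within strict_image, continuous (g \o complete)}.
    apply: within_continuous_comp cg => //.
    by apply: continuous_subspaceT; exact: complete_continuous.
  apply: continuous_rowP => k.
  rewrite (_ : (fun w => _) = (fun y => (poly_of y)`_(d - (s + k.+1))) \o (g \o complete)).
    move=> w; apply: (cvg_comp (g \o complete) _ (cgc w)); exact: poly_of_continuous.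
  by apply/funext => w; rewrite /= mxE.
- by move=> x [].
- move=> w Uw; split; last by rewrite /= projpsi.
  by have [y Cy yw] := Uw; have [] := chamber_stratum Cy (psiP w y Cy yw).
- move=> x [Sx Ux]; have Ux' := Ux; have [y Cy yE] := Ux'.
  apply: proj_inj => //; last by rewrite projpsi.
  by have [] := chamber_stratum Cy (psiP _ y Cy yE).
- by move=> w Uw; rewrite projpsi.
Qed.

Lemma stratum_sa_dim : sa_dim stratum n.
Proof.
split; last by move=> m A V AS oV V0 /(stratum_dim_le AS oV V0).
exists (stratum `&` proj @^-1` strict_image), strict_image; split; first by move=> x [].
split; first exact: strict_image_open.
split; last exact: strict_homeomorphic.
have [y0 Cy0 x0E] := base; exists (proj x0), y0 => //.
by rewrite (complete_proj x0E).
Qed.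

(** By invariance of domain a chart at [x] makes the projection of a neighbourhood open, so the l-th
    coefficient could move both ways with the earlier ones fixed. On a wall [stratum_poly_wall]
    forbids one direction. *)
Lemma rel_interior_strict x : rel_interior stratum n x -> root_mult_comp (hpoly d s f x) u.
Proof.
move=> [Sx [Q [V [oQ [Qx [oV [phi [psi [_ [cpsi [phiV [psiA [psiphi phipsi]]]]]]]]]]]]].
have [y [cy xy yE]] := stratumP Sx.
have [oy|/(open_chamberPn cy)[i0 i0l yi0]] := pselect (open_chamber u (row_fun y)).
  by have [] := chamber_stratum oy xy.
have [y0 Cy0 x0E] := base.
(* For [l <= s] all first [l] coefficients are prescribed, so the root vector is that of the witness
   [x0]. *)
have [n0|n_gt0] := posnP n.
  have yy0 : y = y0.
    apply: top_coefs_inj => //; first exact: open_chamber_weak.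
    rewrite yE /top_coefs -(complete_proj x0E); congr complete.
    by apply/rowP => -[k kn]; exfalso; lia.
  by have [] := chamber_stratum Cy0 (etrans xy (congr1 (fun y => poly_of y) yy0)).
have oI : open ((proj \o psi) @` V).
  apply: invariance_of_domain => //.
    by move=> w; apply: (cvg_comp psi proj (cpsi w)); exact: proj_continuous.
  move=> v w; rewrite !inE => Vv Vw /= /proj_inj vw.
  by rewrite -(phipsi v) // -(phipsi w) // vw //; have [] := psiA _ Vv; have [] := psiA _ Vw.
have [|e e0 he] := (open_normP _).1 oI (proj x).
  by exists (phi x); [exact: phiV|rewrite /= psiphi].
(* The displacement points in the forbidden direction; [e / 2] keeps it inside the open image. *)
pose t : R := (-1) ^+ (l - i0) * (e / 2).
have nl : (n.-1 < n)%N by rewrite prednK.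
have [|v Vv vE] := he (proj x + \row_k (if k == Ordinal nl then t else 0)).
  rewrite addrC addKr; apply: rv_norm_lt => // k; rewrite mxE.
  case: ifP => _; rewrite ?normr0 // /t normrM normrX normrN normr1 expr1n mul1r.
  by rewrite gtr0_norm ?divr_gt0 //; lra.
have [Sx' _] := psiA v Vv; have [y' [cy' xy' yE']] := stratumP Sx'.
have coefE (j : 'I_l) : (poly_of y')`_(d - j.+1) - (poly_of y)`_(d - j.+1) =
    if (j.+1 == l)%N then t else 0.
  move/rowP: yE' => /(_ j); move/rowP: yE => /(_ j); move: vE => /= ->.
  rewrite !mxE => -> ->; have jl := ltn_ord j.
  case: ltnP => js; first by rewrite subrr; case: eqP => // jl'; exfalso; lia.
  have jsn : (j - s < n)%N by lia.
  rewrite !(row_fun_lt _ jsn) !mxE addrAC subrr add0r -val_eqE /=.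
  by congr (if _ then _ else _); apply/eqP/eqP; lia.
have l0 : (0 < l)%N by lia.
have ll : (l.-1 < l)%N by rewrite prednK.
have := coefE (Ordinal ll); rewrite /= prednK // eqxx => lastE.
have t0 : t != 0 by rewrite mulf_neq0 ?signr_eq0 // gt_eqF // divr_gt0.
have := stratum_poly_wall u_gt0 u_sum cy cy' i0l yi0.
rewrite lastE /t mulrA -expr2 sqrr_sign mul1r => h.
suff : e / 2 < 0 by rewrite ltNge divr_ge0 // ltW.
apply: h.
- move=> j jl; apply/esym/eqP; rewrite -subr_eq0.
  by have /= -> := coefE (Ordinal (ltnW jl)); rewrite ltn_eqF.
- apply: contrapT => nE; move: lastE; rewrite (_ : poly_of y' = poly_of y).
    by rewrite subrr => /esym/eqP; apply/negP.
  apply: stratum_poly_ext => i il; apply/esym/eqP; apply: contraT => yi.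
  by exfalso; apply: nE; exists i.
Qed.

Lemma strict_rel_interior x : stratum x -> root_mult_comp (hpoly d s f x) u -> rel_interior stratum n x.
Proof.
move=> Sx xu; split => //; exists (proj @^-1` strict_image), strict_image.
split; first by apply: open_comp; [move=> w _; exact: proj_continuous|exact: strict_image_open].
split; first by have [y Cy xE] := strict_stratumP Sx xu; exists y; rewrite // (complete_proj xE).
by split; [exact: strict_image_open|exact: strict_homeomorphic].
Qed.
End Witness.
End Stratum.

Theorem mainTheorem7 (R : realType) (d : nat) (f : {poly R}) (s : nat)
    (u : seq nat) :
  (1 <= d)%N ->
  f \is monic -> size f = d.+1 -> hyperbolic f ->
  (s <= d)%N ->
  composition d u ->
  (exists x, Hsu d s f u x /\ root_mult_comp (hpoly d s f x) u) ->
  sa_dim (Hsu d s f u) (maxn (size u - s) 0) /\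
  rel_interior (Hsu d s f u) (maxn (size u - s) 0) =
    [set x | Hsu d s f u x /\ root_mult_comp (hpoly d s f x) u].
Proof.
move=> _ _ _ _ sd [u_gt0 u_sum] [x0 [Sx0 x0u]]; rewrite maxn0.
split; first exact: stratum_sa_dim x0u.
apply/seteqP; split => x.
  by move=> ix; split; [case: ix|exact: (rel_interior_strict sd u_gt0 u_sum Sx0 x0u)].
by case=> Sx xu; exact: (strict_rel_interior sd u_gt0 u_sum Sx0 x0u).
Qed.
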